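(* Let $X$ be a projective variety of dimension $n$, let $T$ be a smooth curve with a point $t_0 \in T$, let $Y \to T$ be a family of $n$-dimensional projective varieties (the special fibre over $t_0$ being allowed to have multiplicity), and let $f : X \times T \dashrightarrow Y$ be a family of dominant rational maps $f_t$, defined over all of $T$. Assume that the family $f$ is generically trivial (with respect to $t_0$) and of constant degree, i.e. that $\deg(f_t) = d$ for every $t \in T$. Then the limit map $f_{t_0}$ is in the same birational equivalence class as the general $f_t$ (that is, as the maps $f_t$ with $t \neq t_0$).
   Context: All varieties are over the complex field. Family of varieties with possibly multiple special fibre: $Y \to T$ is a projective morphism from a variety $Y$ whose fibres $Y_t$ are reduced and irreducible of dimension $n$ for $t \ne t_0$, while the fibre over $t_0$ is, as a cycle, of the form $d_0 Y_0$ with $Y_0$ an irreducible (reduced) variety of dimension $n$ and $d_0 \geq 1$. Family of dominant rational maps defined over all of $T$: a rational map $f : X \times T \dashrightarrow Y$ over $T$ that restricts to a dominant rational map $f_t : X \dashrightarrow Y_t$ for every $t \neq t_0$ and to a dominant rational map $f_{t_0} : X \dashrightarrow Y_0$ for $t = t_0$, and such that the graph $\Gamma(f)$, with its natural projection to $T$, is the family of graphs $\Gamma(f_t)$, $t \in T$ (closed graphs of rational maps). Generically trivial: there are a projective variety $V$, a dominant rational map $h : X \dashrightarrow V$ and a birational isomorphism $g : V \times T \dashrightarrow Y$ over $T$, defined over $T - \{t_0\}$ (i.e. restricting to a birational isomorphism $g_t : V \dashrightarrow Y_t$ for every $t \neq t_0$), such that $f = g \circ (h \times 1)$. Thus $f_t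 = g_t \circ h$ for $t \neq t_0$, and all the maps $f_t$ with $t \ne t_0$ are birationally equivalent. Two dominant rational maps $u: X \dashrightarrow Z$ and $u': X \dashrightarrow Z'$ are birationally equivalent if there is a birational isomorphism $b: Z \dashrightarrow Z'$ such that $u' = b \circ u$. *)

(* Defs.v *)
From mathcomp Require Import all_boot all_order all_algebra.
From mathcomp Require Import boolp classical_sets reals.
From mathcomp Require Import complex mpoly.

Set Implicit Arguments.
Unset Strict Implicit.
Unset Printing Implicit Defensive.

Import GRing.Theory.
Local Open Scope ring_scope.
Local Open Scope classical_set_scope.

(* Varieties are classical (quasi-projective) varieties over
   an algebraically closed field: irreducible locally closed subsets of
   projective space, seen as spaces with functions.  The general variety
   notions are stated over an arbitrary algebraically closed [K]; the theorem
   takes [K] to be the complex field.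

   Functions are total, and only their germs matter: a regular function, or a
   rational map, is a total function whose values outside a suitable open set
   are irrelevant. *)

Definition nbhd_in (T : Type) (op : set (set T)) (x : T) (P : T -> Prop) :=
  exists W : set T, [/\ op W, W x & forall y, W y -> P y].

(* [is_open] : the Zariski-open sets.
   [regular_at x phi] : phi represents an element of the stalk at x of the
   structure sheaf of K-valued functions.  The record carries no axioms; it is
   only ever used on projective spaces, their products and their subspaces. *)
Record space (K : closedFieldType) := Space {
  point :> Type;
  is_open : set (set point);
  regular_at : point -> set (point -> K) }.
Arguments is_open {K} s _.
Arguments regular_at {K s} _ _.

Section ProjectiveSpace.
Context (K : closedFieldType) (N : nat).

(* Lines through the origin of K^(N+1). *)
Definition proj_point := {L : {vspace 'rV[K]_N.+1} | \dim L == 1%N}.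

(* One choice of homogeneous coordinates: [vpick L] is a nonzero vector of L. *)
Definition hcoord (x : proj_point) : 'I_N.+1 -> K := fun i => vpick (\val x) 0 i.

Definition proj_closed (Z : set proj_point) :=
  exists S : set {mpoly K[N.+1]},
    (forall p, S p -> exists d : nat, p \is d.-homog) /\
    Z = [set x | forall p, S p -> p.@[hcoord x] = 0].

Definition proj_open (U : set proj_point) := proj_closed (~` U).

Definition proj_regular_at (x : proj_point) (phi : proj_point -> K) :=
  exists (d : nat) (p q : {mpoly K[N.+1]}),
    [/\ p \is d.-homog, q \is d.-homog &
        nbhd_in proj_open x (fun y =>
          q.@[hcoord y] != 0 /\ phi y = p.@[hcoord y] / q.@[hcoord y])].

Definition proj_space : space K := Space proj_open proj_regular_at.

End ProjectiveSpace.

Section Spaces.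
Context (K : closedFieldType).
Implicit Types X Y Z T : space K.

Definition is_closed X (A : set X) := is_open X (~` A).

Definition near_point X (x : X) (P : X -> Prop) := nbhd_in (is_open X) x P.

Definition zariski_closure X (A : set X) : set X :=
  [set x | forall W, is_open X W -> W x -> exists2 y, W y & A y].

Definition locally_closed X (A : set X) :=
  exists U C : set X, [/\ is_open X U, is_closed C & A = U `&` C].

(* The reduced induced structure on a (locally closed) subset. *)
Definition sub_open X (A : set X) (U : set A) :=
  exists2 O : set X, is_open X O & U = [set z | O (\val z)].

Definition sub_regular_at X (A : set X) (z : A) (phi : A -> K) :=
  exists2 psi : X -> K, regular_at (\val z) psi &
    nbhd_in (@sub_open X A) z (fun w => phi w = psi (\val w)).

Definition sub_space X (A : set X) : space K :=
  Space (@sub_open X A) (@sub_regular_at X A).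

(* Products: the functions sum_i phi_i(x) psi_i(y) on open rectangles U x V
   have open non-vanishing loci, which generate the topology, and their
   quotients are locally the regular functions. *)
Definition tensor_function X Y (U : set X) (V : set Y) (a : X * Y -> K) :=
  exists (m : nat) (phi : 'I_m -> X -> K) (psi : 'I_m -> Y -> K),
    [/\ forall i x, U x -> regular_at x (phi i),
        forall i y, V y -> regular_at y (psi i) &
        forall p, a p = \sum_(i < m) phi i p.1 * psi i p.2].

Definition prod_open X Y (W : set (X * Y)) :=
  forall p, W p -> exists (U : set X) (V : set Y) (a : X * Y -> K),
    [/\ is_open X U /\ U p.1, is_open Y V /\ V p.2, tensor_function U V a,
        a p != 0 & forall q, U q.1 -> V q.2 -> a q != 0 -> W q].

Definition prod_regular_at X Y (p : X * Y) (chi : X * Y -> K) :=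
  exists (U : set X) (V : set Y) (a b : X * Y -> K),
    [/\ is_open X U /\ U p.1, is_open Y V /\ V p.2,
        tensor_function U V a, tensor_function U V b &
        nbhd_in (@prod_open X Y) p (fun q => b q != 0 /\ chi q = a q / b q)].

Definition prod_space X Y : space K :=
  Space (@prod_open X Y) (@prod_regular_at X Y).

Definition irreducible X :=
  (exists x : X, True) /\
  forall A B : set X, is_closed A -> is_closed B -> A `|` B = setT ->
    A = setT \/ B = setT.

(* Krull dimension: the largest length of a chain of irreducible closed sets. *)
Definition closed_chain X (n : nat) :=
  exists Z : nat -> set X,
    (forall i, (i <= n)%N -> is_closed (Z i) /\ irreducible (sub_space (Z i))) /\
    (forall i, (i < n)%N -> Z i `<` Z i.+1).

Definition has_dim X (n : nat) := closed_chain X n /\ ~ closed_chain X n.+1.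

(* The maximal ideal m_x of the local ring at x, and its square. *)
Definition max_ideal X (x : X) : set (X -> K) :=
  [set phi | regular_at x phi /\ phi x = 0].

Definition max_ideal_sq X (x : X) : set (X -> K) :=
  [set phi | exists (r : nat) (a b : 'I_r -> X -> K),
    (forall i, max_ideal x (a i) /\ max_ideal x (b i)) /\
    near_point x (fun y => phi y = \sum_(i < r) a i y * b i y)].

(* dim_K (m_x / m_x^2) = n: the classes of s_0, ..., s_(n-1) form a basis. *)
Definition cotangent_dim X (x : X) (n : nat) :=
  exists s : 'I_n -> X -> K, (forall i, max_ideal x (s i)) /\
    forall phi, max_ideal x phi ->
      exists! c : 'rV[K]_n,
        max_ideal_sq x (fun y => phi y - \sum_(i < n) c 0 i * s i y).

Definition smooth_curve X := has_dim X 1 /\ forall x : X, cotangent_dim x 1.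

(* The local ring O_{X,Z} of X along an irreducible closed subset Z, as total
   functions modulo [germ_eq Z].  For Z = {x} it is the stalk at x, and for
   Z = X it is the function field K(X). *)
Definition local_ring X (Z : set X) : set (X -> K) :=
  [set phi | exists2 x, Z x & regular_at x phi].

Definition germ_eq X (Z : set X) (S : Type) (phi psi : X -> S) :=
  exists W : set X, [/\ is_open X W, W `&` Z !=set0 &
    forall x, W x -> phi x = psi x].

Definition is_ideal X (Z : set X) (I : set (X -> K)) :=
  [/\ I `<=` local_ring Z,
      forall phi psi, I phi -> local_ring Z psi -> germ_eq Z phi psi -> I psi,
      I (fun=> 0),
      forall phi psi, I phi -> I psi -> I (fun x => phi x + psi x) &
      forall a phi, local_ring Z a -> I phi -> I (fun x => a x * phi x)].

(* The length of O_{X,Z} / I: the largest length of a chain of ideals of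
   O_{X,Z} containing I. *)
Definition ideal_chain X (Z : set X) (I : set (X -> K)) (m : nat) :=
  exists J : nat -> set (X -> K),
    (forall i, (i <= m)%N -> is_ideal Z (J i) /\ I `<=` J i) /\
    (forall i, (i < m)%N -> J i `<` J i.+1).

Definition quotient_length X (Z : set X) (I : set (X -> K)) (m : nat) :=
  ideal_chain Z I m /\ ~ ideal_chain Z I m.+1.

Definition fibre_set X T (pi : X -> T) (t : T) : set X := [set x | pi x = t].

(* The fibre with its reduced structure. *)
Definition fibre X T (pi : X -> T) (t : T) : space K :=
  sub_space (fibre_set pi t).

(* The ideal m_t O_{X,Z} of the scheme-theoretic fibre over t. *)
Definition fibre_ideal X T (pi : X -> T) (t : T) (Z : set X) : set (X -> K) :=
  [set phi | local_ring Z phi /\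
    exists (r : nat) (a : 'I_r -> X -> K) (s : 'I_r -> T -> K),
      [/\ forall i, local_ring Z (a i), forall i, max_ideal t (s i) &
          germ_eq Z phi (fun x => \sum_(i < r) a i x * s i (pi x))]].

(* The scheme-theoretic fibre is reduced: O_{X,x} / m_t O_{X,x} has no nonzero
   nilpotent, for every closed point x of the fibre. *)
Definition reduced_fibre X T (pi : X -> T) (t : T) :=
  forall x, pi x = t -> forall (phi : X -> K) (k : nat),
    local_ring [set x] phi ->
    fibre_ideal pi t [set x] (fun y => phi y ^+ k) ->
    fibre_ideal pi t [set x] phi.

(* The fibre over t is, as a cycle, m Z with Z irreducible; Z is then the
   reduced fibre [fibre pi t]. *)
Definition fibre_cycle X T (pi : X -> T) (t : T) (m : nat) :=
  let Z := fibre_set pi t in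
  irreducible (sub_space Z) /\ quotient_length Z (fibre_ideal pi t Z) m.

Definition morphism_on X Y (W : set X) (f : X -> Y) :=
  [/\ is_open X W,
      forall V, is_open Y V -> is_open X (W `&` f @^-1` V) &
      forall x psi, W x -> regular_at (f x) psi -> regular_at x (psi \o f)].

(* f represents a rational map from X to Y; two representatives define the
   same rational map when they agree on a nonempty open set. *)
Definition rational X Y (f : X -> Y) :=
  exists2 W : set X, W !=set0 & morphism_on W f.

Definition rat_eq X (S : Type) (f g : X -> S) := germ_eq [set: X] f g.

(* The image of every nonempty open set of definition is dense. *)
Definition dominant X Y (f : X -> Y) :=
  forall W : set X, W !=set0 -> morphism_on W f ->
    zariski_closure (f @` W) = setT.

Definition dominant_rational X Y (f : X -> Y) := rational f /\ dominant f.

Definition birational X Y (f : X -> Y) :=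
  dominant_rational f /\
  exists g : Y -> X, [/\ dominant_rational g, rat_eq (g \o f) id &
                         rat_eq (f \o g) id].

Definition birationally_equivalent X Y Z (u : X -> Y) (v : X -> Z) :=
  exists b : Y -> Z, birational b /\ rat_eq v (b \o u).

(* deg f = [K(X) : f^* K(Y)] = d, witnessed by a basis e of K(X). *)
Definition degree X Y (f : X -> Y) (d : nat) :=
  exists e : 'I_d -> X -> K,
    [/\ forall i, local_ring setT (e i),
        forall phi : X -> K, local_ring setT phi ->
          exists c : 'I_d -> Y -> K, (forall i, local_ring setT (c i)) /\
            rat_eq phi (fun x => \sum_(i < d) c i (f x) * e i x) &
        forall c : 'I_d -> Y -> K, (forall i, local_ring setT (c i)) ->
          rat_eq (fun x => \sum_(i < d) c i (f x) * e i x) (fun=> 0) ->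
          forall i, rat_eq (c i) (fun=> 0)].

(* The closed graph; it does not depend on the open set W of definition. *)
Definition graph X Y (f : X -> Y) : set (prod_space X Y) :=
  [set p | exists W : set X, [/\ W !=set0, morphism_on W f &
    @zariski_closure (prod_space X Y) [set q | W q.1 /\ q.2 = f q.1] p]].

End Spaces.

Record proj_variety (K : closedFieldType) := ProjVariety {
  proj_variety_dim : nat;
  proj_variety_set : set (proj_space K proj_variety_dim);
  proj_variety_closed : is_closed proj_variety_set;
  proj_variety_irreducible : irreducible (sub_space proj_variety_set) }.

Arguments proj_variety_set {K} _ _.

Definition proj_variety_space (K : closedFieldType) (X : proj_variety K) :=
  sub_space (proj_variety_set X).
Coercion proj_variety_space : proj_variety >-> space.

Record quasiproj_variety (K : closedFieldType) := QuasiprojVariety {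
  quasiproj_variety_dim : nat;
  quasiproj_variety_set : set (proj_space K quasiproj_variety_dim);
  quasiproj_variety_locally_closed : locally_closed quasiproj_variety_set;
  quasiproj_variety_irreducible :
    irreducible (sub_space quasiproj_variety_set) }.

Arguments quasiproj_variety_set {K} _ _.

Definition quasiproj_variety_space (K : closedFieldType)
  (X : quasiproj_variety K) := sub_space (quasiproj_variety_set X).
Coercion quasiproj_variety_space : quasiproj_variety >-> space.

(* A variety with a projective morphism to T: a closed irreducible subset of
   P^N x T with the second projection. *)
Record variety_over (K : closedFieldType) (T : space K) := VarietyOver {
  variety_over_dim : nat;
  variety_over_set : set (prod_space (proj_space K variety_over_dim) T);
  variety_over_closed : is_closed variety_over_set;
  variety_over_irreducible : irreducible (sub_space variety_over_set) }.

Arguments variety_over_set {K T} _ _.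

Definition variety_over_space (K : closedFieldType) (T : space K)
  (Y : variety_over T) := sub_space (variety_over_set Y).
Coercion variety_over_space : variety_over >-> space.

Definition structure_map (K : closedFieldType) (T : space K)
  (Y : variety_over T) : Y -> T := fun y => (\val y).2.

Section Families.
Context (K : closedFieldType) (T : space K) (t0 : T) (Y : variety_over T).

Local Notation pi := (@structure_map K T Y).

Definition family_of_varieties (n d0 : nat) :=
  (forall t, t <> t0 ->
    [/\ reduced_fibre pi t, irreducible (fibre pi t) & has_dim (fibre pi t) n])
  /\ [/\ (1 <= d0)%N, fibre_cycle pi t0 d0 & has_dim (fibre pi t0) n].

Definition rational_over (X : space K) (f : prod_space X T -> Y) :=
  rational f /\ rat_eq (pi \o f) snd.

(* The rational map f is defined at some point of X x {t} (possibly through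
   another representative f'), and its restriction to X x {t} = X is ft. *)
Definition restricts_to (X : space K) (f : prod_space X T -> Y) (t : T)
    (ft : X -> fibre pi t) :=
  exists (f' : prod_space X T -> Y) (W : set (prod_space X T)),
    [/\ rat_eq f' f, morphism_on W f', exists x : X, W (x, t) &
        rat_eq (fun x => f' (x, t)) (fun x => \val (ft x))].

(* The fibre of the graph of f over t is, as a cycle, the graph of ft. *)
Definition graph_fibre_is (X : space K) (f : prod_space X T -> Y) (t : T)
    (ft : X -> fibre pi t) :=
  (forall (x : X) (y : Y), graph f ((x, t), y) <->
     exists2 z : fibre pi t, \val z = y & graph ft (x, z)) /\
  fibre_cycle (X := sub_space (graph f)) (fun p => (\val p).1.2) t 1.

(* At t0 the target [fibre pi t0] of [ft t0] is the reduced variety Y_0. *)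
Definition family_of_dominant_maps (X : space K) (f : prod_space X T -> Y)
    (ft : forall t, X -> fibre pi t) :=
  rational_over f /\
  forall t, [/\ restricts_to f (ft t), dominant_rational (ft t) &
                graph_fibre_is f (ft t)].

Definition generically_trivial (X : space K) (f : prod_space X T -> Y) :=
  exists (V : proj_variety K) (h : X -> V) (g : prod_space V T -> Y),
    [/\ dominant_rational h,
        birational g /\ rational_over g,
        forall t, t <> t0 ->
          exists2 gt : V -> fibre pi t, restricts_to g gt & birational gt &
        rat_eq f (fun p => g (h p.1, p.2))].

End Families.

(* Main.v *)
Require Import Defs.
From mathcomp Require Import all_boot all_order all_algebra.
From mathcomp Require Import boolp classical_sets reals.
From mathcomp Require Import complex mpoly.
From mathcomp Require Import ring.

Import Defs.

Set Implicit Arguments.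
Unset Strict Implicit.
Unset Printing Implicit Defensive.

Import GRing.Theory.
Local Open Scope ring_scope.
Local Open Scope classical_set_scope.

(** Write f = g o (h x 1) with g : V x T --> Y birational.  The point is that g,
    which is only assumed to restrict well over t != t0, also has a restriction
    c = g_t0 : V --> Y_t0 to the special fibre.  Indeed the divisor V x t0 has
    codimension one, and a rational map to a projective variety over T can be
    extended to its generic point: the homogeneous coordinates of g are sums
    \sum_k phi_k(v) Psi_jk(t) with the phi_k linearly independent over the base
    field, and dividing all of them by a coefficient Psi_jk of least order at t0
    makes them regular along V x t0 and not all zero there
    (extend_over_fibre).

    This uses that the local ring of T at t0 is a valuation ring
    (divides_total).  Smoothness gives a generator s of the maximal ideal by
    Nakayama's lemma (max_ideal_principal), and no nonzero function is divisible
    by all powers of s (order_of_vanishing), because local rings of varieties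
    are noetherian by Hilbert's basis theorem (mpoly_noetherian).

    Restricting f = g o (h x 1) to the fibres yields f_t = g_t o h for t != t0
    and f_t0 = c o h (restriction_comp).  As g_t is birational,
    [K(X) : h^* K(V)] = deg f_t = d.  But d is also the degree of f_t0, that is
    of K(X) over the subfield h^* c^* K(Y_t0) of h^* K(V).  Hence c^* is onto
    K(V) (pullback_surjective), so c is birational (birational_of_surjective),
    and f_t = (g_t o c^-1) o f_t0.

    Rational maps are handled through identities between total functions that
    hold generically, that is on a nonempty open set; irreducibility lets
    finitely many of them be used together at a generic point. *)

(** * Spaces with a Zariski-like topology and a sheaf of functions *)

(** What the argument uses of the Zariski topology and of the structure sheaf.
    It passes to subspaces and to products, so that every variety in sight is
    covered by the single base case of projective space. *)
Record geometric (K : closedFieldType) (X : space K) : Prop := Geometric {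
  openT : is_open X setT;
  openI : forall A B, is_open X A -> is_open X B -> is_open X (A `&` B);
  open_local : forall A : set X, (forall x, A x -> near_point x A) -> is_open X A;
  reg_near : forall (x : X) phi, regular_at x phi ->
    near_point x (fun y => regular_at y phi);
  reg_eq : forall (x : X) (phi psi : X -> K), regular_at x phi ->
    near_point x (fun y => psi y = phi y) -> regular_at x psi;
  reg_cst : forall (x : X) c, regular_at x (fun=> c);
  reg_add : forall (x : X) phi psi, regular_at x phi -> regular_at x psi ->
    regular_at x (fun y => phi y + psi y);
  reg_mul : forall (x : X) phi psi, regular_at x phi -> regular_at x psi ->
    regular_at x (fun y => phi y * psi y);
  reg_inv : forall (x : X) phi, regular_at x phi -> phi x != 0 ->
    regular_at x (fun y => (phi y)^-1);
  reg_neq0 : forall (x : X) phi, regular_at x phi -> phi x != 0 ->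
    near_point x (fun y => phi y != 0) }.

Section Geometric.
Context (K : closedFieldType) (X : space K) (gX : geometric X).
Implicit Types (x : X) (phi psi : X -> K) (A B : set X).

Lemma near_open A x : is_open X A -> A x -> near_point x A.
Proof. by move=> oA Ax; exists A; split. Qed.

Lemma nearT x (P : X -> Prop) : (forall y, P y) -> near_point x P.
Proof. by move=> h; exists setT; split=> //; exact: openT gX. Qed.

Lemma nearW x (P Q : X -> Prop) : (forall y, P y -> Q y) ->
  near_point x P -> near_point x Q.
Proof. by move=> h [A [oA Ax hA]]; exists A; split=> // y /hA /h. Qed.

Lemma nearI x (P Q : X -> Prop) : near_point x P -> near_point x Q ->
  near_point x (fun y => P y /\ Q y).
Proof.
move=> [A [oA Ax hA]] [B [oB Bx hB]]; exists (A `&` B); split=> //.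
- exact: openI gX _ _ oA oB.
- by move=> y [/hA ? /hB ?].
Qed.

Lemma near_self x (P : X -> Prop) : near_point x P -> P x.
Proof. by move=> [A [_ Ax]]; apply. Qed.

Lemma near_near x (P : X -> Prop) : near_point x P ->
  near_point x (fun y => near_point y P).
Proof. by move=> [A [oA Ax hA]]; exists A; split=> // y Ay; exists A. Qed.

Lemma open_near (P : X -> Prop) : is_open X [set x | near_point x P].
Proof. by apply: (open_local gX) => x /near_near. Qed.

Lemma near_ord n x (P : 'I_n -> X -> Prop) : (forall i, near_point x (P i)) ->
  near_point x (fun y => forall i, P i y).
Proof.
elim: n P => [|n IH] P h; first by apply: nearT => y [].
have := nearI (h ord0) (IH (fun i => P (lift ord0 i)) (fun i => h _)).
apply: nearW => y [h0 hS] i.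
by case: (unliftP ord0 i) => [j|] ->.
Qed.

Lemma open_neq0 A phi : is_open X A -> (forall x, A x -> regular_at x phi) ->
  is_open X [set x | A x /\ phi x != 0].
Proof.
move=> oA rA; apply: (open_local gX) => x [Ax px].
exact: nearI (near_open oA Ax) (reg_neq0 gX (rA _ Ax) px).
Qed.

Lemma reg_opp x phi : regular_at x phi -> regular_at x (fun y => - phi y).
Proof.
move=> h; apply: (reg_eq gX (reg_mul gX (reg_cst gX x (-1)) h)).
by apply: nearT => y; rewrite mulN1r.
Qed.

Lemma reg_sub x phi psi : regular_at x phi -> regular_at x psi ->
  regular_at x (fun y => phi y - psi y).
Proof. by move=> h1 /reg_opp h2; exact: reg_add gX _ _ _ h1 h2. Qed.

Lemma reg_div x phi psi : regular_at x phi -> regular_at x psi -> psi x != 0 ->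
  regular_at x (fun y => phi y / psi y).
Proof. by move=> h1 h2 /(reg_inv gX h2); exact: reg_mul gX _ _ _ h1. Qed.

Lemma reg_sum (I : Type) (r : seq I) (P : pred I) (F : I -> X -> K) x :
  (forall i, P i -> regular_at x (F i)) ->
  regular_at x (fun y => \sum_(i <- r | P i) F i y).
Proof.
move=> h; have -> : (fun y => \sum_(i <- r | P i) F i y) =
  \big[(fun a b => fun y => a y + b y)/(fun=> 0)]_(i <- r | P i) F i.
  by apply/funext => y; elim/big_rec2: _ => // i a b _ <-.
elim/big_rec: _ => [|i a Pi ra]; first exact: reg_cst.
by apply: (reg_add gX) => //; exact: h.
Qed.

Lemma reg_prod (I : Type) (r : seq I) (P : pred I) (F : I -> X -> K) x :
  (forall i, P i -> regular_at x (F i)) ->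
  regular_at x (fun y => \prod_(i <- r | P i) F i y).
Proof.
move=> h; have -> : (fun y => \prod_(i <- r | P i) F i y) =
  \big[(fun a b => fun y => a y * b y)/(fun=> 1)]_(i <- r | P i) F i.
  by apply/funext => y; elim/big_rec2: _ => // i a b _ <-.
elim/big_rec: _ => [|i a Pi ra]; first exact: reg_cst.
by apply: (reg_mul gX) => //; exact: h.
Qed.

Lemma reg_exp x phi k : regular_at x phi -> regular_at x (fun y => phi y ^+ k).
Proof.
move=> h; have -> : (fun y => phi y ^+ k) = (fun y => \prod_(i < k) phi y).
  by apply/funext => y; rewrite big_const_ord -Monoid.iteropE.
exact: reg_prod.
Qed.

Lemma reg_meval m (p : {mpoly K[m]}) (v : 'I_m -> X -> K) x :
  (forall i, regular_at x (v i)) -> regular_at x (fun y => p.@[fun i => v i y]).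
Proof.
move=> h; have -> : (fun y => p.@[fun i => v i y]) = (fun y =>
  \sum_(m <- msupp p) p@_m * \prod_i v i y ^+ m i).
  by apply/funext => y; rewrite mevalE.
apply: reg_sum => k _; apply: (reg_mul gX); first exact: reg_cst.
by apply: reg_prod => i _; exact: reg_exp.
Qed.

End Geometric.

(** * Projective space *)

Section ProjectiveSpace.
Context (K : closedFieldType) (N : nat).
Local Notation P := (proj_space K N).
Implicit Types (x y : P) (p q : {mpoly K[N.+1]}).

Lemma meval_homog m (p : {mpoly K[m]}) d (c : K) (v : 'I_m -> K) :
  p \is d.-homog -> p.@[fun i => c * v i] = c ^+ d * p.@[v].
Proof.
move=> /dhomogP hp; rewrite !mevalE mulr_sumr big_seq [RHS]big_seq.
apply: eq_bigr => mm /hp /= <-; rewrite mulrCA; congr (_ * _).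
rewrite [mdeg _]mdegE /= -prodrXr -big_split /=.
by apply: eq_bigr => i _; rewrite exprMn.
Qed.

Lemma homog_coord i : ('X_i : {mpoly K[N.+1]}) \is 1.-homog.
Proof. by rewrite dhomogX; exact/eqP/mdeg1. Qed.

Lemma vpick_neq0 (x : P) : vpick (\val x) != 0.
Proof.
by rewrite vpick0 -dimv_eq0 (eqP (valP x)).
Qed.

Lemma hcoord_neq0 x : exists i, hcoord x i != 0.
Proof.
apply: contrapT => h; move: (vpick_neq0 x); apply/negP; rewrite negbK.
apply/eqP/rowP => i; rewrite mxE; apply/eqP/negPn/negP => hi.
by apply: h; exists i.
Qed.

(** The sets p != 0 with p homogeneous are a basis of the topology; this turns
    finite intersections into products of polynomials. *)
Lemma proj_openP (U : set P) : proj_open U <->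
  forall x, U x -> exists d p, [/\ p \is d.-homog, p.@[hcoord x] != 0 &
    forall y, p.@[hcoord y] != 0 -> U y].
Proof.
split=> [[S [hS eS]] x Ux|h].
  have : ~ (~` U) x by [].
  rewrite eS /= => /existsNP [p /not_implyP [Sp /eqP px]].
  have [d hd] := hS _ Sp; exists d, p; split=> // y py.
  apply: contrapT => nU; have : (~` U) y by [].
  by rewrite eS /= => /(_ _ Sp) h; rewrite h eqxx in py.
exists [set p | (exists d : nat, p \is d.-homog) /\
  forall y, ~ U y -> p.@[hcoord y] = 0]; split; first by move=> p [].
apply/seteqP; split=> x /= hx; first by move=> p [_]; apply.
move=> Ux; have [d [p [hp px hU]]] := h _ Ux.
move/eqP: px; apply; apply: hx; split=> [|y nU]; first by exists d.
by apply/eqP/negPn/negP => /hU.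
Qed.

Lemma proj_open_nz p d : p \is d.-homog ->
  proj_open [set x : P | p.@[hcoord x] != 0].
Proof. by move=> hp; apply/proj_openP => x /= px; exists d, p. Qed.

Lemma hcoord_open i : proj_open [set x : P | hcoord x i != 0].
Proof.
suff -> : [set x : P | hcoord x i != 0] =
    [set x | ('X_i : {mpoly K[N.+1]}).@[hcoord x] != 0].
  exact: proj_open_nz (homog_coord i).
by apply/seteqP; split=> x /=; rewrite mevalXU.
Qed.

Lemma proj_openI (A B : set P) :
  proj_open A -> proj_open B -> proj_open (A `&` B).
Proof.
move=> /proj_openP oA /proj_openP oB; apply/proj_openP => x [Ax Bx].
have [d [p [hp px hA]]] := oA _ Ax; have [e [q [hq qx hB]]] := oB _ Bx.
exists (d + e)%N, (p * q); split; first exact: dhomogM.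
  by rewrite mevalM mulf_neq0.
move=> y; rewrite mevalM mulf_eq0 negb_or => /andP [? ?].
by split; [exact: hA | exact: hB].
Qed.

(** The denominator need only be nonzero at the point itself, which is the form
    suited to inverting a regular function. *)
Lemma proj_regP x phi : @proj_regular_at K N x phi <->
  exists (d : nat) p q, [/\ p \is d.-homog, q \is d.-homog, q.@[hcoord x] != 0 &
    nbhd_in (@proj_open K N) x (fun y => phi y = p.@[hcoord y] / q.@[hcoord y])].
Proof.
split=> [[d [p [q [hp hq [W [oW Wx hW]]]]]]|[d [p [q [hp hq qx [W [oW Wx hW]]]]]]].
  exists d, p, q; split=> //; first by case: (hW _ Wx).
  by exists W; split=> // y /hW [].
exists d, p, q; split=> //; exists (W `&` [set y | q.@[hcoord y] != 0]); split.
- by apply: proj_openI => //; exact: proj_open_nz hq.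
- by [].
- by move=> y [/hW].
Qed.

Lemma proj_geometric : geometric P.
Proof.
have nI x (A B : P -> Prop) : nbhd_in (@proj_open K N) x A ->
  nbhd_in (@proj_open K N) x B -> nbhd_in (@proj_open K N) x (fun y => A y /\ B y).
  move=> [U [oU Ux hU]] [V [oV Vx hV]]; exists (U `&` V); split=> //.
  - exact: proj_openI.
  - by move=> y [/hU ? /hV].
split.
- apply/proj_openP => x _; exists 0%N, 1; split=> //; first exact: dhomog1.
  by rewrite meval1 oner_neq0.
- exact: proj_openI.
- move=> A h; apply/proj_openP => x /h [W [/proj_openP oW Wx WA]].
  have [d [p [hp px hW]]] := oW _ Wx.
  by exists d, p; split=> // y /hW /WA.
- move=> x phi [d [p [q [hp hq [W [oW Wx hW]]]]]].
  by exists W; split=> // y Wy; exists d, p, q; split=> //; exists W.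
- move=> x phi psi [d [p [q [hp hq hW]]]] h.
  exists d, p, q; split=> //; have [W [oW Wx {}hW]] := nI _ _ _ hW h.
  by exists W; split=> // y /hW [[? <-]].
- move=> x c; exists 0%N, c%:MP, 1; split; [|exact: dhomog1|].
    by rewrite -[c%:MP]mulr1 mul_mpolyC; apply: dhomogZ; exact: dhomog1.
  exists setT; split=> //.
    apply/proj_openP => y _; exists 0%N, 1; split=> //; first exact: dhomog1.
    by rewrite meval1 oner_neq0.
  by move=> y _; rewrite meval1 mevalC divr1 oner_neq0.
- move=> x phi psi [d [p [q [hp hq hW]]]] [e [r [s [hr hs hV]]]].
  exists (d + e)%N, (p * s + r * q), (q * s); split.
  + apply: dhomogD; first exact: dhomogM.
    by rewrite addnC; exact: dhomogM.
  + exact: dhomogM.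
  + have [W [oW Wx {}hW]] := nI _ _ _ hW hV; exists W; split=> // y.
    move=> /hW [[q0 ->] [s0 ->]].
    by rewrite mevalD !mevalM mulf_neq0 // addf_div.
- move=> x phi psi [d [p [q [hp hq hW]]]] [e [r [s [hr hs hV]]]].
  exists (d + e)%N, (p * r), (q * s); split; [exact: dhomogM|exact: dhomogM|].
  have [W [oW Wx {}hW]] := nI _ _ _ hW hV; exists W; split=> // y.
  move=> /hW [[q0 ->] [s0 ->]].
  by rewrite !mevalM mulf_neq0 // mulf_div.
- move=> x phi [d [p [q [hp hq [W [oW Wx hW]]]]]] px.
  apply/proj_regP; exists d, q, p; split=> //.
    by move: px; have [_ ->] := hW _ Wx; rewrite mulf_eq0 negb_or => /andP [].
  by exists W; split=> // y /hW [_ ->]; rewrite invf_div.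
- move=> x phi [d [p [q [hp hq hW]]]] px.
  have [W [oW Wx {}hW]] : nbhd_in (@proj_open K N) x (fun y =>
    (q.@[hcoord y] != 0 /\ phi y = p.@[hcoord y] / q.@[hcoord y]) /\
    p.@[hcoord y] != 0).
    apply: nI => //; case: hW => W [oW Wx hW].
    exists [set y | p.@[hcoord y] != 0]; split=> //; first exact: proj_open_nz hp.
    by move: px; have [_ ->] := hW _ Wx; rewrite mulf_eq0 negb_or => /andP [].
  exists W; split=> // y /hW [[q0 ->] p0].
  by rewrite mulf_neq0 // invr_eq0.
Qed.

End ProjectiveSpace.

(** * Subspaces and products *)

Lemma sub_geometric (K : closedFieldType) (X : space K) (A : set X) :
  geometric X -> geometric (sub_space A).
Proof.
move=> gX.
have oI (U V : set A) : sub_open U -> sub_open V -> sub_open (U `&` V).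
  move=> [O oO ->] [O' oO' ->]; exists (O `&` O') => //.
  exact: openI gX _ _ oO oO'.
have near_sub (z : A) (P : X -> Prop) : near_point (\val z) P ->
  nbhd_in (@sub_open K X A) z (fun w => P (\val w)).
  move=> [W [oW Wz hW]]; exists [set w | W (\val w)]; split=> //.
    by exists W.
  by move=> y /hW.
have nI (z : A) (P Q : A -> Prop) : nbhd_in (@sub_open K X A) z P ->
  nbhd_in (@sub_open K X A) z Q ->
  nbhd_in (@sub_open K X A) z (fun y => P y /\ Q y).
  move=> [U [oU Ux hU]] [V [oV Vx hV]]; exists (U `&` V); split=> //.
  - exact: oI.
  - by move=> y [/hU ? /hV].
split=> //.
- by exists setT => //; exact: openT gX.
- move=> U h; exists [set x | near_point x (fun y => forall w : A, \val w = y -> U w)].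
    exact: open_near.
  apply/seteqP; split=> z /=; last by move=> /near_self; apply.
  move=> /h [W [[O oO ->] Oz OU]]; exists O; split=> // y Oy w wy.
  by apply: OU => /=; rewrite wy.
- move=> z phi [psi rpsi hphi].
  have := nI _ _ _ (near_sub _ _ (reg_near gX rpsi)) hphi.
  move=> [W [oW Wz hW]]; exists W; split=> // w Ww; exists psi.
    by case: (hW _ Ww).
  by exists W; split=> // v /hW [].
- move=> z phi psi [chi rchi hphi] h; exists chi => //.
  have [W [oW Wz hW]] := nI _ _ _ hphi h.
  by exists W; split=> // v /hW [<-].
- move=> z c; exists (fun=> c); first exact: reg_cst.
  by exists setT; split=> //; exists setT => //; exact: openT gX.
- move=> z phi psi [a ra ha] [b rb hb]; exists (fun x => a x + b x).
    exact: reg_add.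
  have [W [oW Wz hW]] := nI _ _ _ ha hb.
  by exists W; split=> // v /hW [-> ->].
- move=> z phi psi [a ra ha] [b rb hb]; exists (fun x => a x * b x).
    exact: reg_mul.
  have [W [oW Wz hW]] := nI _ _ _ ha hb.
  by exists W; split=> // v /hW [-> ->].
- move=> z phi [a ra [W [oW Wz ha]]] pz; exists (fun x => (a x)^-1).
    by apply: (reg_inv gX) => //; rewrite -ha.
  by exists W; split=> // v /ha ->.
- move=> z phi [a ra hW] pz; have az : a (\val z) != 0.
    by case: hW => W [oW Wz hW]; rewrite -hW.
  have [W [oW Wz h]] := nI _ _ _ (near_sub _ _ (reg_neq0 gX ra az)) hW.
  by exists W; split=> // v /h [? ->].
Qed.

Section Tensor.
Context (K : closedFieldType) (X Y : space K).
Implicit Types (U : set X) (V : set Y) (a b : X * Y -> K).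

(** Arbitrary finite index types make sums and products of tensor functions
    immediate, by disjoint unions and pairs of indices. *)
Lemma tensor_fin (I : finType) U V (phi : I -> X -> K) (psi : I -> Y -> K) a :
  (forall i x, U x -> regular_at x (phi i)) ->
  (forall i y, V y -> regular_at y (psi i)) ->
  (forall p, a p = \sum_i phi i p.1 * psi i p.2) -> tensor_function U V a.
Proof.
move=> hU hV ha; exists #|I|, (phi \o enum_val), (psi \o enum_val); split.
- by move=> i x; exact: hU.
- by move=> i y; exact: hV.
by move=> p; rewrite ha (reindex _ (onW_bij _ (@enum_val_bij I))).
Qed.

Lemma tensorW U U' V V' a : U' `<=` U -> V' `<=` V ->
  tensor_function U V a -> tensor_function U' V' a.
Proof.
move=> sU sV [m [phi [psi [h1 h2 h3]]]]; exists m, phi, psi; split=> //.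
- by move=> i x /sU; exact: h1.
- by move=> i x /sV; exact: h2.
Qed.

Lemma tensor_add U V a b : tensor_function U V a -> tensor_function U V b ->
  tensor_function U V (fun p => a p + b p).
Proof.
move=> [m [phi [psi [h1 h2 h3]]]] [m' [phi' [psi' [h1' h2' h3']]]].
apply: (@tensor_fin ('I_m + 'I_m')%type U V
  (fun i => match i with inl j => phi j | inr j => phi' j end)
  (fun i => match i with inl j => psi j | inr j => psi' j end)).
- by case=> i x; [exact: h1|exact: h1'].
- by case=> i x; [exact: h2|exact: h2'].
by move=> p; rewrite big_sumType /= h3 h3'.
Qed.

Context (gX : geometric X) (gY : geometric Y).

Lemma tensor_mul U V a b : tensor_function U V a -> tensor_function U V b ->
  tensor_function U V (fun p => a p * b p).
Proof.
move=> [m [phi [psi [h1 h2 h3]]]] [m' [phi' [psi' [h1' h2' h3']]]].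
apply: (@tensor_fin ('I_m * 'I_m')%type U V
  (fun i x => phi i.1 x * phi' i.2 x) (fun i y => psi i.1 y * psi' i.2 y)).
- by move=> i x Ux; apply: (reg_mul gX); [exact: h1|exact: h1'].
- by move=> i x Ux; apply: (reg_mul gY); [exact: h2|exact: h2'].
move=> p; rewrite h3 h3' big_distrlr /= pair_big /=.
by apply: eq_bigr => i _; rewrite mulrACA.
Qed.

Lemma tensor_fst U V (phi : X -> K) : (forall x, U x -> regular_at x phi) ->
  tensor_function U V (fun p => phi p.1).
Proof.
move=> h; apply: (@tensor_fin unit _ _ (fun=> phi) (fun _ _ => 1)).
- by move=> _.
- by move=> _ y _; exact: reg_cst.
- by move=> p; rewrite big_const card_unit /= addr0 mulr1.
Qed.

Lemma tensor_snd U V (psi : Y -> K) : (forall y, V y -> regular_at y psi) ->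
  tensor_function U V (fun p => psi p.2).
Proof.
move=> h; apply: (@tensor_fin unit _ _ (fun _ _ => 1) (fun=> psi)).
- by move=> _ y _; exact: reg_cst.
- by move=> _.
- by move=> p; rewrite big_const card_unit /= addr0 mul1r.
Qed.

Lemma tensor_cst U V c : tensor_function U V (fun=> c).
Proof. by apply: (@tensor_fst U V (fun=> c)) => x _; exact: reg_cst. Qed.

Lemma prod_open_basic U V a : is_open X U -> is_open Y V ->
  tensor_function U V a ->
  prod_open [set p : X * Y | [/\ U p.1, V p.2 & a p != 0]].
Proof. by move=> oU oV ta p [Up Vp ap]; exists U, V, a; split. Qed.

Lemma prod_openX U V : is_open X U -> is_open Y V ->
  prod_open [set p : X * Y | U p.1 /\ V p.2].
Proof.
move=> oU oV p [Up Vp]; exists U, V, (fun=> 1); split=> //.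
- exact: tensor_cst.
- exact: oner_neq0.
Qed.

Lemma prod_openI (A B : set (X * Y)) :
  prod_open A -> prod_open B -> prod_open (A `&` B).
Proof.
move=> oA oB p [/oA [U [V [a [[oU Up] [oV Vp] ta ap hA]]]]].
move=> /oB [U' [V' [b [[oU' Up'] [oV' Vp'] tb bp hB]]]].
exists (U `&` U'), (V `&` V'), (fun p => a p * b p); split.
- by split=> //; exact: openI gX _ _ oU oU'.
- by split=> //; exact: openI gY _ _ oV oV'.
- apply: tensor_mul; first by apply: tensorW ta; exact: subIsetl.
  by apply: tensorW tb; exact: subIsetr.
- by rewrite mulf_neq0.
move=> q [Uq Uq'] [Vq Vq']; rewrite mulf_eq0 negb_or => /andP [aq bq].
by split; [exact: hA|exact: hB].
Qed.

Lemma prod_nearI p (P Q : X * Y -> Prop) :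
  nbhd_in (@prod_open K X Y) p P -> nbhd_in (@prod_open K X Y) p Q ->
  nbhd_in (@prod_open K X Y) p (fun y => P y /\ Q y).
Proof.
move=> [U [oU Ux hU]] [V [oV Vx hV]]; exists (U `&` V); split=> //.
- exact: prod_openI.
- by move=> y [/hU ? /hV].
Qed.

Lemma prod_regP p (chi : X * Y -> K) : prod_regular_at p chi <->
  exists (U : set X) (V : set Y) (a b : X * Y -> K),
    [/\ is_open X U /\ U p.1, is_open Y V /\ V p.2,
        tensor_function U V a, tensor_function U V b & b p != 0 /\
        nbhd_in (@prod_open K X Y) p (fun q => chi q = a q / b q)].
Proof.
split=> [] [U [V [a [b [[oU Up] [oV Vp] ta tb]]]]].
  move=> [W [oW Wp hW]]; exists U, V, a, b; split=> //; split.
    by case: (hW _ Wp).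
  by exists W; split=> // q /hW [].
move=> [bp hW]; exists U, V, a, b; split=> //.
have : nbhd_in (@prod_open K X Y) p [set p : X * Y | [/\ U p.1, V p.2 & b p != 0]].
  by eexists; split; [exact: (prod_open_basic oU oV tb)|by []|].
move=> /(prod_nearI hW) [O [oO Op hO]]; exists O; split=> // q /hO.
by move=> [-> []].
Qed.

Lemma prod_geometric : geometric (prod_space X Y).
Proof.
split.
- move=> p _; exists setT, setT, (fun=> 1).
  split=> //; [|by split=> //; exact: openT gY|exact: tensor_cst|exact: oner_neq0].
  by split=> //; exact: openT gX.
- exact: prod_openI.
- move=> A h p /h [W [oW Wp WA]].
  have [U [V [a [hU hV ta ap hW]]]] := oW _ Wp.
  exists U, V, a; split=> // q Uq Vq aq.
  exact/WA/hW.
- move=> p chi [U [V [a [b [[oU Up] [oV Vp] ta tb]]]]] hW.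
  have [] := prod_nearI hW (P := _) (Q := [set p : X * Y | U p.1 /\ V p.2]).
    by exists [set p : X * Y | U p.1 /\ V p.2]; split=> //; exact: prod_openX.
  move=> O [oO Op hO]; exists O; split=> // q /[dup] Oq /hO [_ [Uq Vq]].
  by exists U, V, a, b; split=> //; exists O; split=> // r /hO [].
- move=> p chi psi [U [V [a [b [hU hV ta tb hW]]]]] h.
  exists U, V, a, b; split=> //.
  have [W [oW Wp {}hW]] := prod_nearI hW h.
  by exists W; split=> // q /hW [[? <-]].
- move=> p c; apply/prod_regP; exists setT, setT, (fun=> c), (fun=> 1).
  split; [|by split=> //; exact: openT gY|exact: tensor_cst|exact: tensor_cst|].
    by split=> //; exact: openT gX.
  split; first exact: oner_neq0.
  exists [set p | setT p.1 /\ setT p.2]; split=> //.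
    by apply: prod_openX; [exact: openT gX|exact: openT gY].
  by move=> q _; rewrite divr1.
- move=> p phi psi [U [V [a [b [[oU Up] [oV Vp] ta tb hW]]]]].
  move=> [U' [V' [a' [b' [[oU' Up'] [oV' Vp'] ta' tb' hW']]]]].
  have sU1 := @subIsetl _ U U'; have sU2 := @subIsetr _ U U'.
  have sV1 := @subIsetl _ V V'; have sV2 := @subIsetr _ V V'.
  have {}ta := tensorW sU1 sV1 ta; have {}tb := tensorW sU1 sV1 tb.
  have {}ta' := tensorW sU2 sV2 ta'; have {}tb' := tensorW sU2 sV2 tb'.
  exists (U `&` U'), (V `&` V'), (fun q => a q * b' q + a' q * b q),
    (fun q => b q * b' q); split.
  + by split=> //; exact: openI gX _ _ oU oU'.
  + by split=> //; exact: openI gY _ _ oV oV'.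
  + by apply: tensor_add; exact: tensor_mul.
  + exact: tensor_mul.
  + have [W [oW Wp h]] := prod_nearI hW hW'; exists W; split=> // q /h.
    by move=> [[b0 ->] [b0' ->]]; rewrite mulf_neq0 // addf_div.
- move=> p phi psi [U [V [a [b [[oU Up] [oV Vp] ta tb hW]]]]].
  move=> [U' [V' [a' [b' [[oU' Up'] [oV' Vp'] ta' tb' hW']]]]].
  have sU1 := @subIsetl _ U U'; have sU2 := @subIsetr _ U U'.
  have sV1 := @subIsetl _ V V'; have sV2 := @subIsetr _ V V'.
  have {}ta := tensorW sU1 sV1 ta; have {}tb := tensorW sU1 sV1 tb.
  have {}ta' := tensorW sU2 sV2 ta'; have {}tb' := tensorW sU2 sV2 tb'.
  exists (U `&` U'), (V `&` V'), (fun q => a q * a' q),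
    (fun q => b q * b' q); split.
  + by split=> //; exact: openI gX _ _ oU oU'.
  + by split=> //; exact: openI gY _ _ oV oV'.
  + exact: tensor_mul.
  + exact: tensor_mul.
  + have [W [oW Wp h]] := prod_nearI hW hW'; exists W; split=> // q /h.
    by move=> [[b0 ->] [b0' ->]]; rewrite mulf_neq0 // mulf_div.
- move=> p phi [U [V [a [b [hU hV ta tb hW]]]]] pp.
  apply/prod_regP; exists U, V, b, a; split=> //.
  case: hW => W [oW Wp hW]; split; last first.
    by exists W; split=> // q /hW [_ ->]; rewrite invf_div.
  by move: pp; have [_ ->] := hW _ Wp; rewrite mulf_eq0 negb_or => /andP [].
- move=> p phi [U [V [a [b [[oU Up] [oV Vp] ta tb hW]]]]] pp.
  have ap : a p != 0.
    case: hW => W [oW Wp hW].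
    by move: pp; have [_ ->] := hW _ Wp; rewrite mulf_eq0 negb_or => /andP [].
  have [] := prod_nearI hW (Q := [set p : X * Y | [/\ U p.1, V p.2 & a p != 0]]).
    by eexists; split; [exact: (prod_open_basic oU oV ta)|by []|].
  move=> O [oO Op hO]; exists O; split=> // q /hO [[b0 ->] [_ _ a0]].
  by rewrite mulf_neq0 // invr_eq0.
Qed.

End Tensor.

(** * Irreducible spaces, separation and morphisms *)

Section Irreducible.
Context (K : closedFieldType) (X : space K).
Implicit Types (A B : set X).

Lemma open_meet A B : irreducible X -> is_open X A -> is_open X B ->
  A !=set0 -> B !=set0 -> A `&` B !=set0.
Proof.
move=> [_ irr] oA oB [a Aa] [b Bb]; apply: contrapT => /set0P/negP/negPn/eqP h.
have [||||] := irr (~` A) (~` B); rewrite /is_closed ?setCK //.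
- by rewrite -setCI h setC0.
- by move/seteqP=> [_ /(_ a I)].
- by move/seteqP=> [_ /(_ b I)].
Qed.

Context (gX : geometric X).

Context (irr : irreducible X).

(** The form in which irreducibility is used: finitely many generic properties
    hold simultaneously on one nonempty open set, so that identities between
    rational maps can be manipulated pointwise. *)
Definition generically (P : X -> Prop) :=
  exists W : set X, [/\ is_open X W, W !=set0 & forall x, W x -> P x].

Lemma genericallyW (P Q : X -> Prop) : (forall x, P x -> Q x) ->
  generically P -> generically Q.
Proof. by move=> h [W [oW nW hW]]; exists W; split=> // x /hW /h. Qed.

Lemma genericallyI (P Q : X -> Prop) : generically P -> generically Q ->
  generically (fun x => P x /\ Q x).
Proof.
move=> [U [oU nU hU]] [V [oV nV hV]]; exists (U `&` V); split.
- exact: openI gX _ _ oU oV.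
- exact: open_meet.
- by move=> x [/hU ? /hV].
Qed.

Lemma generically_near x (P : X -> Prop) : near_point x P -> generically P.
Proof. by move=> [W [oW Wx hW]]; exists W; split=> //; exists x. Qed.

Lemma generically_ex (P : X -> Prop) : generically P -> exists x, P x.
Proof. by move=> [W [_ [x Wx] hW]]; exists x; exact: hW. Qed.

Lemma generically_ord n (P : 'I_n -> X -> Prop) :
  (forall i, generically (P i)) -> generically (fun y => forall i, P i y).
Proof.
elim: n P => [|n IH] P h.
  have [[x _] _] := irr.
  by exists setT; split=> //; [exact: openT gX|exists x|move=> y _ []].
have := genericallyI (h ord0) (IH (fun i => P (lift ord0 i)) (fun i => h _)).
apply: genericallyW => y [h0 hS] i.
by case: (unliftP ord0 i) => [j|] ->.
Qed.

Lemma rat_eqP (S : Type) (f g : X -> S) :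
  rat_eq f g <-> generically (fun x => f x = g x).
Proof.
split; first by move=> [W [oW nW h]]; exists W; split=> //; rewrite -(setIT W).
by move=> [W [oW nW h]]; exists W; split=> //; rewrite setIT.
Qed.

Lemma generically_reg (phi : X -> K) : local_ring setT phi ->
  generically (fun x => regular_at x phi).
Proof. by move=> [x _ /(reg_near gX)]; exact: generically_near. Qed.

Lemma local_ring_generic (phi : X -> K) :
  generically (fun x => regular_at x phi) -> local_ring setT phi.
Proof. by move=> /generically_ex [x h]; exists x. Qed.

Lemma generically_neq0 (phi : X -> K) : local_ring setT phi ->
  ~ rat_eq phi (fun=> 0) -> generically (fun x => phi x != 0).
Proof.
move=> /generically_reg [W [oW nW hW]] h.
exists [set x | W x /\ phi x != 0]; split; last by move=> x [].
- exact: open_neq0.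
apply: contrapT => h'; apply: h; apply/rat_eqP.
exists W; split=> // x Wx; apply/eqP/negPn/negP => px.
by apply: h'; exists x.
Qed.

(** On an irreducible space a function regular at x has an open non-vanishing
    locus near x, which is empty or dense; so a germ is determined by its
    generic values. *)
Lemma near0_generic (phi : X -> K) x : regular_at x phi ->
  rat_eq phi (fun=> 0) -> near_point x (fun y => phi y = 0).
Proof.
move=> /(reg_near gX) [W [oW Wx hW]] /rat_eqP [V [oV nV hV]].
exists W; split=> // y Wy; apply/eqP/negPn/negP => py.
have [] := @open_meet [set y | W y /\ phi y != 0] V irr _ oV _ nV.
- exact: open_neq0.
- by exists y.
by move=> z [[_ pz] /hV e]; rewrite e eqxx in pz.
Qed.

Lemma near_eq_generic (phi psi : X -> K) x : regular_at x phi ->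
  regular_at x psi -> rat_eq phi psi -> near_point x (fun y => phi y = psi y).
Proof.
move=> rp rq /rat_eqP h; have := near0_generic (reg_sub gX rp rq).
case=> [|W [oW Wx hW]].
  by apply/rat_eqP; apply: genericallyW h => y ->; rewrite subrr.
by exists W; split=> // y /hW /eqP; rewrite subr_eq0 => /eqP.
Qed.

End Irreducible.

(** A substitute for the closedness of the diagonal, stable under subspaces and
    products, from which equalizers of morphisms are seen to be closed. *)
Definition separated (K : closedFieldType) (X : space K) :=
  forall x y : X, x <> y -> exists phi : X -> K,
    [/\ regular_at x phi, regular_at y phi & phi x != phi y].

Section Morphism.
Context (K : closedFieldType) (X Y : space K) (gX : geometric X).
Implicit Types (W : set X).

Lemma morphism_onI W (f : X -> Y) : is_open X W ->
  (forall x V, W x -> is_open Y V -> V (f x) -> near_point x (V \o f)) ->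
  (forall x psi, W x -> regular_at (f x) psi -> regular_at x (psi \o f)) ->
  morphism_on W f.
Proof.
move=> oW cW rW; split=> // V oV; apply: (open_local gX) => x [Wx Vx].
exact (nearI gX (near_open oW Wx) (cW x V Wx oV Vx)).
Qed.

Lemma morphism_near W (f : X -> Y) x (P : Y -> Prop) : morphism_on W f -> W x ->
  near_point (f x) P -> near_point x (fun x => P (f x)).
Proof.
move=> [oW cW _] Wx [V [oV Vx hV]]; exists (W `&` f @^-1` V); split=> //.
- exact: cW.
- by move=> y [_ /hV].
Qed.

Lemma morphism_sub W W' (f : X -> Y) : is_open X W' -> W' `<=` W ->
  morphism_on W f -> morphism_on W' f.
Proof.
move=> oW' sW mW; apply: morphism_onI => //.
- move=> x V /sW Wx oV Vx; have := morphism_near mW Wx (near_open oV Vx).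
  by apply: nearW.
- by move=> x psi /sW Wx; case: mW => _ _; exact.
Qed.

Lemma morphism_eq W (f g : X -> Y) : (forall x, W x -> f x = g x) ->
  morphism_on W f -> morphism_on W g.
Proof.
move=> e mf; have [oW cf rf] := mf; apply: morphism_onI => // x.
- move=> V Wx oV; rewrite -e // => Vx.
  have := nearI gX (near_open oW Wx) (morphism_near mf Wx (near_open oV Vx)).
  by apply: nearW => y [Wy]; rewrite /= e.
- move=> psi Wx; rewrite -e // => /(rf _ _ Wx) h; apply: (reg_eq gX h).
  by exists W; split=> // y Wy /=; rewrite e.
Qed.


End Morphism.

Section MorphismOps.
Context (K : closedFieldType) (X Y Z : space K).
Context (gX : geometric X) (gY : geometric Y) (gZ : geometric Z).
Implicit Types (W : set X).

Lemma morphism_comp W (V : set Y) (f : X -> Y) (g : Y -> Z) :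
  morphism_on W f -> morphism_on V g -> morphism_on (W `&` f @^-1` V) (g \o f).
Proof.
move=> mf mg; have [oW cf rf] := mf; have [oV cg rg] := mg.
apply: morphism_onI => //; first exact: cf.
- move=> x O [Wx Vx] oO Ox.
  apply: (morphism_near mf Wx (P := fun y => O (g y))).
  by exists (V `&` g @^-1` O); split=> [||y []] //; exact: cg.
- move=> x psi [Wx Vx] h.
  exact: (rf x (psi \o g) Wx (rg _ _ Vx h)).
Qed.

Lemma morphism_id : morphism_on setT (id : X -> X).
Proof.
apply: morphism_onI => //; first exact: openT gX.
by move=> x V _ oV Vx; exists V.
Qed.

Lemma morphism_cst (y : Y) : morphism_on setT (fun=> y : Y) (X := X).
Proof.
apply: morphism_onI => //; first exact: openT gX.
- by move=> x V _ oV Vx; apply: nearT.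
- by move=> x psi _ _; exact: (reg_cst gX x (psi y)).
Qed.

Lemma morphism_fst : @morphism_on K (prod_space X Y) X setT fst.
Proof.
have gXY := prod_geometric gX gY.
apply: morphism_onI => //; first exact: openT gXY.
- move=> x V _ oV Vx; exists [set p | V p.1 /\ setT p.2]; split=> //.
    by apply: prod_openX => //; exact: openT gY.
  by move=> y [].
- move=> x psi _ /(reg_near gX) [W [oW Wx hW]].
  exists W, setT, (fun p => psi p.1), (fun=> 1); split=> //.
  + by split=> //; exact: openT gY.
  + exact: tensor_fst.
  + exact: tensor_cst.
  + apply: (@nearT K (prod_space X Y)) => // q.
    by split; [exact: oner_neq0|rewrite divr1].
Qed.

Lemma morphism_snd : @morphism_on K (prod_space X Y) Y setT snd.
Proof.
have gXY := prod_geometric gX gY.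
apply: morphism_onI => //; first exact: openT gXY.
- move=> x V _ oV Vx; exists [set p | setT p.1 /\ V p.2]; split=> //.
    by apply: prod_openX => //; exact: openT gX.
  by move=> y [].
- move=> x psi _ /(reg_near gY) [W [oW Wx hW]].
  exists setT, W, (fun p => psi p.2), (fun=> 1); split=> //.
  + by split=> //; exact: openT gX.
  + exact: tensor_snd.
  + exact: tensor_cst.
  + apply: (@nearT K (prod_space X Y)) => // q.
    by split; [exact: oner_neq0|rewrite divr1].
Qed.

(** Since the topology of a product and its regular functions are both generated
    by tensor functions, this is what makes a pair of morphisms a morphism. *)
Lemma tensor_pullback W (u : X -> Y) (w : X -> Z) (U : set Y) (V : set Z) a x :
  morphism_on W u -> morphism_on W w -> W x -> U (u x) -> V (w x) ->
  tensor_function U V a -> regular_at x (fun x => a (u x, w x)).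
Proof.
move=> [_ _ ru] [_ _ rw] Wx Ux Vx [m [phi [psi [h1 h2 h3]]]].
have -> : (fun x => a (u x, w x)) =
  (fun x => \sum_(i < m) (phi i \o u) x * (psi i \o w) x).
  by apply/funext => y; rewrite h3.
apply: (reg_sum gX) => i _.
by apply: (reg_mul gX); [apply: ru => //; exact: h1|apply: rw => //; exact: h2].
Qed.

Lemma morphism_pair W (u : X -> Y) (w : X -> Z) :
  morphism_on W u -> morphism_on W w ->
  @morphism_on K X (prod_space Y Z) W (fun x => (u x, w x)).
Proof.
move=> mu mw.
have cP x (O : set (Y * Z)) : W x -> prod_open O -> O (u x, w x) ->
    near_point x (fun x => O (u x, w x)).
  move=> Wx oO /oO [U [V [a [[oU Ux] [oV Vx] ta ax hO]]]].
  have [Wo _ _] := mu.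
  have := nearI gX (morphism_near mu Wx (near_open oU Ux))
    (nearI gX (morphism_near mw Wx (near_open oV Vx))
    (reg_neq0 gX (tensor_pullback mu mw Wx Ux Vx ta) ax)).
  by apply: nearW => y [Uy [Vy ay]]; exact: hO.
apply: morphism_onI => //; first by case: mu.
move=> x chi Wx [U [V [a [b [[oU Ux] [oV Vx] ta tb [O [oO Ox hO]]]]]]].
have ra := tensor_pullback mu mw Wx Ux Vx ta.
have rb := tensor_pullback mu mw Wx Ux Vx tb.
apply: (reg_eq gX (reg_div gX ra rb _)); first by case: (hO _ Ox).
by apply: nearW (cP _ _ Wx oO Ox) => y /hO [].
Qed.

End MorphismOps.

Section MorphismSub.
Context (K : closedFieldType) (X Y : space K).
Context (gX : geometric X) (gY : geometric Y) (A : set Y).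

Lemma morphism_val : @morphism_on K (sub_space A) Y setT (fun z => \val z).
Proof.
have gA := sub_geometric A gY.
apply: morphism_onI => //; first exact: openT gA.
- move=> x V _ oV Vx; exists [set z : A | V (\val z)]; split=> //.
  by exists V.
- by move=> x psi _ h; exists psi => //; exact: (nearT gA).
Qed.

Lemma morphism_into_sub W (f : X -> sub_space A) :
  @morphism_on K X Y W (\val \o f) -> morphism_on W f.
Proof.
move=> mf; apply: morphism_onI => //; first by case: mf.
- move=> x V Wx [O oO ->] Ox.
  exact: (morphism_near mf Wx (near_open oO Ox)).
- move=> x psi Wx [chi rchi [V [[O oO ->] Ox hV]]].
  have [_ _ rf] := mf; apply: (reg_eq gX (rf _ _ Wx rchi)).
  by apply: nearW (morphism_near mf Wx (near_open oO Ox)) => y /hV.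
Qed.

End MorphismSub.

Section Density.
Context (K : closedFieldType) (X Y : space K) (gX : geometric X).
Lemma morphism_neq W (f g : X -> Y) x : separated Y ->
  morphism_on W f -> morphism_on W g -> W x -> f x <> g x ->
  near_point x (fun y => f y <> g y).
Proof.
move=> sY mf mg Wx /sY [phi [r1 r2 n12]].
have [_ _ rf] := mf; have [_ _ rg] := mg.
have := reg_neq0 gX (reg_sub gX (rf _ _ Wx r1) (rg _ _ Wx r2)).
rewrite /= subr_eq0 => /(_ n12); apply: nearW => y + e.
by rewrite e subrr eqxx.
Qed.

Context (irr : irreducible X).

(** Two morphisms into a separated space agree on a closed set, hence
    everywhere as soon as they agree generically. *)
Lemma morphism_ext W (f g : X -> Y) : separated Y ->
  morphism_on W f -> morphism_on W g -> rat_eq f g -> forall x, W x -> f x = g x.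
Proof.
move=> sY mf mg /rat_eqP e x Wx; apply: contrapT => /(morphism_neq sY mf mg Wx).
by move=> /generically_near /(genericallyI gX irr e) /generically_ex [y []].
Qed.

Lemma morphism_closed W (f : X -> Y) (C : set Y) : is_closed C ->
  morphism_on W f -> generically (fun x => C (f x)) -> forall x, W x -> C (f x).
Proof.
move=> cC mf h x Wx; apply: contrapT => nC.
have := morphism_near mf Wx (near_open cC nC).
by move=> /generically_near /(genericallyI gX irr h) /generically_ex [y []].
Qed.

End Density.

Lemma sub_separated (K : closedFieldType) (X : space K) (A : set X) :
  geometric X -> separated X -> separated (sub_space A).
Proof.
move=> gX sX x y nxy; have /sX [phi [rx ry n]] : \val x <> \val y by move=> /val_inj.
have [_ _ r] := @morphism_val K X gX A.
by exists (phi \o \val); split=> //; exact: r.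
Qed.

Lemma prod_separated (K : closedFieldType) (X Y : space K) :
  geometric X -> geometric Y -> separated X -> separated Y ->
  separated (prod_space X Y).
Proof.
move=> gX gY sX sY [x y] [x' y'] n.
have [_ _ r1] := morphism_fst gX gY; have [_ _ r2] := morphism_snd gX gY.
case: (pselect (x = x')) => [ex|/sX [phi [rx ry nx]]]; last first.
  by exists (phi \o fst); split=> //; exact: r1.
case: (pselect (y = y')) => [ey|/sY [phi [rx ry nx]]].
  by case: n; rewrite ex ey.
by exists (phi \o snd); split=> //; exact: r2.
Qed.

(** Two points in the complements of two proper closed sets can be moved, first
    along one factor and then along the other, to a common point outside both
    sets, by the irreducibility of the slices. *)
Lemma prod_irreducible (K : closedFieldType) (X Y : space K) :
  geometric X -> geometric Y -> irreducible X -> irreducible Y ->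
  irreducible (prod_space X Y).
Proof.
move=> gX gY iX iY; have gXY := prod_geometric gX gY.
have [[x0 _] hX] := iX; have [[y0 _] hY] := iY.
split; first by exists (x0, y0).
(* (x1, y1) is outside A and (x2, y2) outside B. A generic x keeps both (x, y1)
   outside A and (x, y2) outside B; then a generic y serves both. *)
move=> A B cA cB eAB; apply: contrapT => /not_orP [nA nB].
have mX y : @morphism_on K X (prod_space X Y) setT (fun x => (x, y)).
  by apply: morphism_pair => //; [exact: morphism_id|exact: morphism_cst].
have mY x : @morphism_on K Y (prod_space X Y) setT (fun y => (x, y)).
  by apply: morphism_pair => //; [exact: morphism_cst|exact: morphism_id].
have [[x1 y1] A1] : exists p, ~ A p.
  by apply: contrapT => h; apply: nA; apply/seteqP; split=> // p _;
     apply: contrapT => h'; apply: h; exists p.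
have [[x2 y2] B2] : exists p, ~ B p.
  by apply: contrapT => h; apply: nB; apply/seteqP; split=> // p _;
     apply: contrapT => h'; apply: h; exists p.
have H1 := morphism_near (mX y1) (I : setT x1) (near_open cA A1).
have H2 := morphism_near (mX y2) (I : setT x2) (near_open cB B2).
have [x [Ax Bx]] := generically_ex (genericallyI gX iX
  (generically_near H1) (generically_near H2)).
have H3 := morphism_near (mY x) (I : setT y1) (near_open cA Ax).
have H4 := morphism_near (mY x) (I : setT y2) (near_open cB Bx).
have [y [Ay By]] := generically_ex (genericallyI gY iY
  (generically_near H3) (generically_near H4)).
have : (A `|` B) (x, y) by rewrite eAB.
by case.
Qed.

(** * Morphisms to projective space *)

Section ProjectivePoints.
Context (K : closedFieldType) (N : nat).
Local Notation P := (proj_space K N).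
Implicit Types (x y : P).

Lemma proj_line x (v : 'rV[K]_N.+1) : v \in \val x -> v != 0 ->
  \val x = <[v]>%VS.
Proof.
move=> vx v0; apply/esym/eqP.
by rewrite eqEdim (eqP (valP x)) dim_vline v0 leqnn andbT -memvE.
Qed.

Lemma proj_ext x y (c : K) : (forall j, hcoord x j = c * hcoord y j) -> x = y.
Proof.
move=> h; apply: val_inj.
have e : vpick (\val x) = c *: vpick (\val y).
  by apply/rowP => j; rewrite mxE; exact: h.
rewrite (proj_line (memv_pick _) (vpick_neq0 x)); apply/esym/proj_line.
  by rewrite e memvZ ?memv_pick.
exact: vpick_neq0.
Qed.

(** The point with homogeneous coordinates v; the value x0 is only taken at
    v = 0. *)
Definition proj_pt (x0 : P) (v : 'I_N.+1 -> K) : P :=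
  insubd x0 <[\row_j v j]>%VS.

Lemma proj_ptE x0 (v : 'I_N.+1 -> K) : (exists j, v j != 0) ->
  exists2 c, c != 0 & forall j, hcoord (proj_pt x0 v) j = c * v j.
Proof.
move=> [j0 vj0].
have v0 : \row_j v j != 0.
  by apply: contraNneq vj0 => /rowP/(_ j0); rewrite !mxE => ->.
have e : \val (proj_pt x0 v) = <[\row_j v j]>%VS.
  by rewrite /proj_pt insubdK // unfold_in dim_vline v0.
have : vpick (\val (proj_pt x0 v)) \in <[\row_j v j]>%VS by rewrite -e memv_pick.
move=> /vlineP [c hc]; exists c.
  by apply: contraNneq (vpick_neq0 (proj_pt x0 v)) => c0; rewrite hc c0 scale0r.
by move=> j; rewrite /hcoord hc !mxE.
Qed.

Lemma lin_homog (c : 'I_N.+1 -> K) : \sum_i c i *: 'X_i \is 1.-homog.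
Proof.
by apply: rpred_sum => i _; apply: rpredZ; exact: homog_coord.
Qed.

Lemma lin_eval (c : 'I_N.+1 -> K) (v : 'I_N.+1 -> K) :
  (\sum_i c i *: 'X_i).@[v] = \sum_i c i * v i.
Proof. by rewrite raddf_sum; apply: eq_bigr => i _; rewrite /= mevalZ mevalXU. Qed.

Lemma regular_frac x d (p q : {mpoly K[N.+1]}) : p \is d.-homog ->
  q \is d.-homog -> q.@[hcoord x] != 0 ->
  @regular_at K P x (fun y => p.@[hcoord y] / q.@[hcoord y]).
Proof.
move=> hp hq qx; apply/proj_regP; exists d, p, q; split=> //.
exists setT; split=> //; exact: openT (proj_geometric K N).
Qed.

Definition coord_ratio i j : P -> K := fun x => hcoord x j / hcoord x i.

Lemma regular_coord i j x : hcoord x i != 0 -> regular_at x (coord_ratio i j).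
Proof.
move=> xi; have gP := proj_geometric K N.
have := @regular_frac x 1 _ _ (homog_coord K j) (homog_coord K i).
rewrite mevalXU => /(_ xi) r; apply: (reg_eq gP r).
by apply: (nearT gP) => y; rewrite !mevalXU.
Qed.

(** Two points of projective space lie in a common affine chart, the complement
    of a hyperplane, and there the affine coordinates separate them. *)
Lemma proj_separated : separated P.
Proof.
move=> x y nxy.
have [c [cx cy]] : exists c : 'I_N.+1 -> K,
    \sum_i c i * hcoord x i != 0 /\ \sum_i c i * hcoord y i != 0.
  have dl (z : P) k : \sum_i (i == k)%:R * hcoord z i = hcoord z k.
    rewrite (bigD1 k) //= eqxx mul1r big1 ?addr0 // => i /negbTE ->.
    by rewrite mul0r.
  have [i xi] := hcoord_neq0 x; have [j yj] := hcoord_neq0 y.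
  have [yi|yi] := eqVneq (hcoord y i) 0; last first.
    by exists (fun k => (k == i)%:R); rewrite !dl.
  have [xj|xj] := eqVneq (hcoord x j) 0; last first.
    by exists (fun k => (k == j)%:R); rewrite !dl.
  (* x_i != 0 = y_i and x_j = 0 != y_j: the sum of the two coordinates works. *)
  exists (fun k => (k == i)%:R + (k == j)%:R).
  split; under eq_bigr do rewrite mulrDl; rewrite big_split /= !dl.
    by rewrite xj addr0.
  by rewrite yi add0r.
pose l (z : P) := \sum_i c i * hcoord z i.
have r z k : l z != 0 -> regular_at z (fun w : P => hcoord w k / l w).
  move=> lz; have := @regular_frac z 1 _ _ (homog_coord K k) (lin_homog c).
  rewrite lin_eval => /(_ lz) r.
  apply: (reg_eq (proj_geometric K N) r).
  by apply: (nearT (proj_geometric K N)) => w; rewrite mevalXU lin_eval.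
apply: contrapT => h; apply: nxy; apply: (@proj_ext _ _ (l x / l y)) => j.
apply/eqP/negPn/negP => nj; apply: h.
exists (fun w => hcoord w j / l w); split; [exact: r|exact: r|].
have ly : l y != 0 by exact: cy.
apply: contra nj; rewrite eqr_div // => /eqP e; apply/eqP.
by rewrite mulrAC -[LHS](mulfK ly) e mulrC [in RHS]mulrC [hcoord y j * _]mulrC.
Qed.

End ProjectivePoints.

(** The scalar c, which depends on x, accounts for the choice of coordinates made
    by hcoord; it cancels from every homogeneous condition. *)
Lemma morphism_proj (K : closedFieldType) (N : nat) (X : space K)
    (W : set X) (A : 'I_N.+1 -> X -> K)
    (u : X -> proj_space K N) : geometric X -> is_open X W ->
  (forall (x : X) j, W x -> regular_at x (A j)) ->
  (forall x : X, W x -> exists2 c, c != 0 & forall j, hcoord (u x) j = c * A j x) ->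
  morphism_on W u.
Proof.
move=> gX oW rA hu.
have ev (x : X) (p : {mpoly K[N.+1]}) d : W x -> p \is d.-homog -> exists2 c, c != 0 &
    p.@[hcoord (u x)] = c ^+ d * p.@[fun j => A j x].
  move=> Wx hp; have [c c0 hc] := hu _ Wx; exists c => //.
  by rewrite -(meval_homog _ _ hp); apply: meval_eq.
apply: morphism_onI => //.
- move=> x V Wx /proj_openP oV /oV [d [p [hp px hV]]].
  have rp := reg_meval gX p (fun j => rA x j Wx).
  have px' : p.@[fun j => A j x] != 0.
    have [c c0 e] := ev _ _ _ Wx hp.
    by move: px; rewrite e mulf_eq0 negb_or => /andP [].
  have := nearI gX (near_open oW Wx) (reg_neq0 gX rp px').
  apply: nearW => y [Wy py]; apply: hV.
  by have [c c0 ->] := ev _ _ _ Wy hp; rewrite mulf_neq0 // expf_neq0.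
move=> x psi Wx /proj_regP [d [p [q [hp hq qx [V [oV Vx hV]]]]]].
have rp := reg_meval gX p (fun j => rA x j Wx).
have rq := reg_meval gX q (fun j => rA x j Wx).
have qx' : q.@[fun j => A j x] != 0.
  have [c c0 e] := ev _ _ _ Wx hq.
  by move: qx; rewrite e mulf_eq0 negb_or => /andP [].
apply: (reg_eq gX (reg_div gX rp rq qx')).
have hN : near_point x (fun y => V (u y)).
  move/proj_openP: oV => /(_ _ Vx) [e [r [hr rx hV']]].
  have rr := reg_meval gX r (fun j => rA x j Wx).
  have rx' : r.@[fun j => A j x] != 0.
    have [c c0 ec] := ev _ _ _ Wx hr.
    by move: rx; rewrite ec mulf_eq0 negb_or => /andP [].
  have := nearI gX (near_open oW Wx) (reg_neq0 gX rr rx').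
  apply: nearW => y [Wy ry]; apply: hV'.
  by have [c c0 ->] := ev _ _ _ Wy hr; rewrite mulf_neq0 // expf_neq0.
have := nearI gX (near_open oW Wx) hN; apply: nearW => y [Wy Vy] /=.
rewrite hV //; have [c c0 hc] := hu _ Wy.
rewrite (meval_eq _ hc) [in q.@[_]](meval_eq _ hc) (meval_homog _ _ hp) (meval_homog _ _ hq).
by rewrite -mulf_div divff ?mul1r // expf_neq0.
Qed.


(** * Dominant rational maps *)

Section Dominant.
Context (K : closedFieldType) (X Y : space K) (gX : geometric X).
Implicit Types (f : X -> Y).

(** For a rational map, dominance means exactly that generic properties pull back
    to generic properties; see dominantP for the converse. *)
Lemma generically_pullback f (P : Y -> Prop) : dominant_rational f ->
  generically P -> generically (P \o f).
Proof.
move=> [[W nW mW] df] [O [oO [y Oy] hO]].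
have h : zariski_closure (f @` W) y by rewrite df.
have [z Oz [x Wx e]] := h _ oO Oy; rewrite -e in Oz.
exists (W `&` f @^-1` O); split; last by move=> ? [_ /hO].
- by case: mW => _ cW _; exact: cW.
- by exists x.
Qed.

Lemma pullback_rat_eq (S : Type) f (u v : Y -> S) : dominant_rational f ->
  rat_eq u v -> rat_eq (u \o f) (v \o f).
Proof. by move=> df /rat_eqP /(generically_pullback df) h; apply/rat_eqP. Qed.

Context (irrX : irreducible X).

Lemma dominantP f : (forall P, generically P -> generically (P \o f)) -> dominant f.
Proof.
move=> h W nW mW; apply/seteqP; split=> // y _ O oO Oy.
have /h gO : generically O by exists O; split=> //; exists y.
have gW : generically W by exists W; split=> //; case: mW.
have [x [Wx Ox]] := generically_ex (genericallyI gX irrX gW gO).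
by exists (f x) => //; exists x.
Qed.

Lemma local_ring_pullback f (phi : Y -> K) : geometric Y -> dominant_rational f ->
  local_ring setT phi -> local_ring setT (phi \o f).
Proof.
move=> gY df /(generically_reg gY) h; have [[W nW mW] _] := df.
have gW : generically W by exists W; split=> //; case: mW.
have [x [Wx hx]] := generically_ex (genericallyI gX irrX gW
  (generically_pullback df h)).
by exists x => //; case: mW => _ _; apply.
Qed.

End Dominant.

Lemma dominant_rational_comp (K : closedFieldType) (X Y Z : space K)
    (f : X -> Y) (g : Y -> Z) : geometric X -> irreducible X ->
  dominant_rational f -> dominant_rational g -> dominant_rational (g \o f).
Proof.
move=> gX iX df dg; have [[W nW mW] _] := df; have [[V nV mV] _] := dg.
split; last first.
  by apply: dominantP => // P /(generically_pullback dg)/(generically_pullback df).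
exists (W `&` f @^-1` V); last exact: morphism_comp.
have gW : generically W by exists W; split=> //; case: mW.
have gV : generically V by exists V; split=> //; case: mV.
exact: generically_ex (genericallyI gX iX gW (generically_pullback df gV)).
Qed.

(** * Degree and birationality *)

Lemma birational_comp (K : closedFieldType) (X Y Z : space K)
    (f : X -> Y) (g : Y -> Z) : geometric X -> irreducible X ->
  geometric Y -> irreducible Y -> geometric Z -> irreducible Z ->
  birational f -> birational g -> birational (g \o f).
Proof.
move=> gX iX gY iY gZ iZ [df [f' [df' ff' f'f]]] [dg [g' [dg' gg' g'g]]].
split; first exact: dominant_rational_comp.
exists (f' \o g'); split; first exact: dominant_rational_comp.
- move/rat_eqP: ff' => ff'; move/rat_eqP: (pullback_rat_eq df gg') => gg.
  apply/rat_eqP; apply: genericallyW (genericallyI gX iX ff' gg).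
  by move=> x /= [e ->].
- move/rat_eqP: g'g => g'g; move/rat_eqP: (pullback_rat_eq dg' f'f) => ff.
  apply/rat_eqP; apply: genericallyW (genericallyI gZ iZ g'g ff).
  by move=> x /= [e ->].
Qed.

(** A dominant rational map out of a projective variety whose pullback is onto
    the function field is birational: the coordinates of the inverse are the
    functions pulling back to the coordinates of the source. *)
Lemma birational_of_surjective (K : closedFieldType) (V : proj_variety K)
    (Z : space K) (c : V -> Z) : geometric Z -> irreducible Z -> separated Z ->
  dominant_rational c ->
  (forall phi : V -> K, local_ring setT phi ->
    exists2 psi : Z -> K, local_ring setT psi & rat_eq phi (psi \o c)) ->
  birational c.
Proof.
move=> gZ iZ sZ dc sc.
pose N := proj_variety_dim V; pose A := proj_variety_set V.
have gP := proj_geometric K N.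
have gV : geometric V := sub_geometric A gP.
have iV : irreducible V := @proj_variety_irreducible K V.
have [[v1 _] _] := iV.
have [i v1i] := hcoord_neq0 (\val v1 : proj_space K N).
have [_ _ rval] := @morphism_val K _ gP A.
pose eta j : V -> K := coord_ratio i j \o (fun v : V => \val v).
have reta j : regular_at v1 (eta j) by apply: rval => //; exact: regular_coord.
have /boolp.choice [psi hpsi] : forall j, exists psi : Z -> K,
    local_ring setT psi /\ rat_eq (eta j) (psi \o c).
  move=> j; have [|psi] := sc (eta j); last by exists psi.
  by exists v1.
pose beta z : proj_space K N := proj_pt (\val v1) (fun j => psi j z).
pose b z : V := insubd v1 (beta z).
have chartV : generically (fun v : V => hcoord (\val v : proj_space K N) i != 0).
  apply: (generically_near (x := v1)).
  have oi := near_open (X := proj_space K N) (hcoord_open K i) v1i.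
  exact: (morphism_near (morphism_val gP A) I oi).
have betac : generically (fun v : V => beta (c v) = \val v).
  have h : generically (fun v : V => forall j, eta j v = psi j (c v)).
    by apply: (generically_ord gV iV) => j; apply/rat_eqP; case: (hpsi j).
  apply: genericallyW (genericallyI gV iV chartV h) => v [vi hv].
  have [|k k0 hk] := @proj_ptE K N (\val v1) (fun j => psi j (c v)).
    by exists i; rewrite -hv /eta /= /coord_ratio divff ?oner_neq0.
  apply: (@proj_ext _ _ _ _ (k / hcoord (\val v : proj_space K N) i)) => j.
  by rewrite hk -hv /eta /= /coord_ratio mulrA mulrAC.
have bc : generically (fun v : V => b (c v) = v).
  apply: genericallyW betac => v e; rewrite /b e; apply: val_inj.
  by rewrite insubdK // (valP v).
pose W1 := [set z : Z | near_point z (fun z =>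
  (forall j, regular_at z (psi j)) /\ psi i z != 0)].
have oW1 : is_open Z W1 := open_near gZ _.
have W1P z : W1 z -> (forall j, regular_at z (psi j)) /\ psi i z != 0 by move/near_self.
have nW1 : generically W1.
  have h1 : generically (fun z => forall j, regular_at z (psi j)).
    by apply: (generically_ord gZ iZ) => j; apply: generically_reg => //; case: (hpsi j).
  have h2 : generically (fun z => psi i z != 0).
    have [r e] := hpsi i; apply: (generically_neq0 gZ r) => e0.
    have /rat_eqP := pullback_rat_eq dc e0; move/rat_eqP: e => e.
    move=> /(genericallyI gV iV e) /(genericallyI gV iV chartV) /generically_ex.
    move=> [v [vi [/= e1 e2]]]; move: e1; rewrite e2 /eta /= /coord_ratio divff //.
    by move/eqP; rewrite oner_eq0.
  have [W [oW nW hW]] := genericallyI gZ iZ h1 h2.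
  by exists W; split=> // z Wz; exists W.
have mbeta : @morphism_on K Z (proj_space K N) W1 beta.
  apply: (morphism_proj (A := psi)) => //; first by move=> z j /W1P [].
  move=> z /W1P [_ pi0]; apply: proj_ptE; by exists i.
have cA : is_closed (A : set (proj_space K N)) := @proj_variety_closed K V.
(* beta lands in the closed set A on the image of c, which is dense. *)
have betaA z : W1 z -> A (beta z).
  move=> Wz; apply: contrapT => nA.
  have := morphism_near mbeta Wz (near_open cA nA).
  move=> /generically_near /(generically_pullback dc) /(genericallyI gV iV betac).
  move=> /generically_ex [v [/= ->]]; apply; exact: set_mem (valP v).
have mb : morphism_on W1 b.
  apply: morphism_into_sub => //; apply: (morphism_eq gZ _ mbeta) => z Wz.
  by rewrite /= /b insubdK //; apply: mem_set; exact: betaA.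
have rb : rational b.
  by have [W [_ [z Wz] h]] := nW1; exists W1 => //; exists z; exact: h.
have db : dominant b.
  apply: (dominantP gZ iZ) => P [O [oO nO hO]].
  have gO : generically O by exists O.
  have [v [Ov [Wv e]]] := generically_ex (genericallyI gV iV gO
    (genericallyI gV iV (generically_pullback dc nW1) bc)).
  have : near_point (b (c v)) O by apply: near_open; rewrite // e.
  move=> /(morphism_near mb Wv) /generically_near.
  by apply: genericallyW => z /hO.
split=> //; exists b; split=> //; first exact/rat_eqP.
(* c o b = id holds on the dense image of c because b o c = id, and equalizers
   are closed. *)
have [[Wc nWc mc] _] := dc; have [oWc _ _] := mc.
pose W2 := W1 `&` b @^-1` Wc.
have m2 : morphism_on W2 (c \o b) by exact: morphism_comp mb mc.
have nW2 : W2 !=set0.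
  have gW : generically Wc by exists Wc.
  have [v [Wv [W1v e]]] := generically_ex (genericallyI gV iV gW
    (genericallyI gV iV (generically_pullback dc nW1) bc)).
  by exists (c v); split=> //=; rewrite e.
apply/rat_eqP; exists W2; split=> //; first by case: m2.
move=> z Wz; apply: contrapT => ne.
have mid : morphism_on W2 (id : Z -> Z).
  by apply: morphism_sub (morphism_id gZ) => //; case: m2.
have := morphism_neq gZ sZ m2 mid Wz ne.
move=> /generically_near /(generically_pullback dc) /(genericallyI gV iV bc).
by move=> /generically_ex [v [e]] /=; rewrite e.
Qed.

Section Degree.
Context (K : closedFieldType) (X V : space K).
Context (gX : geometric X) (iX : irreducible X).
Context (gV : geometric V) (iV : irreducible V).

Lemma local_ring_sum (n : nat) (F : 'I_n -> X -> K) :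
  (forall i, local_ring setT (F i)) ->
  local_ring setT (fun x => \sum_(i < n) F i x).
Proof.
move=> h; apply: local_ring_generic.
have : generically (fun x => forall i, regular_at x (F i)).
  by apply: generically_ord => // i; exact: generically_reg.
by apply: genericallyW => x hx; apply: reg_sum.
Qed.

Lemma local_ring_mul (a b : X -> K) : local_ring setT a -> local_ring setT b ->
  local_ring setT (fun x => a x * b x).
Proof.
move=> /(generically_reg gX) ha /(generically_reg gX) hb.
apply: local_ring_generic; apply: genericallyW (genericallyI gX iX ha hb).
by move=> x [? ?]; exact: reg_mul.
Qed.

Lemma local_ring_sub (a b : X -> K) : local_ring setT a -> local_ring setT b ->
  local_ring setT (fun x => a x - b x).
Proof.
move=> /(generically_reg gX) ha /(generically_reg gX) hb.
apply: local_ring_generic; apply: genericallyW (genericallyI gX iX ha hb).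
by move=> x [? ?]; exact: reg_sub.
Qed.

Lemma local_ring_cst (c : K) : local_ring setT (fun _ : X => c).
Proof. by have [[x _] _] := iX; exists x => //; exact: reg_cst. Qed.

(** A basis of K(X) over u^* K(Y) is one over h^* K(V), because g identifies
    K(Y) with K(V). *)
Lemma degree_birational (Y : space K) (h : X -> V) (g : V -> Y) (u : X -> Y) d :
  geometric Y -> irreducible Y ->
  dominant_rational h -> birational g -> rat_eq u (g \o h) ->
  degree u d -> degree h d.
Proof.
move=> gY iY dh [dg [g' [dg' gg' g'g]]] /rat_eqP e [b [rb sp fr]].
exists b; split=> //.
- move=> phi /sp [c [rc hc]]; exists (fun i => c i \o g); split.
    by move=> i; exact: local_ring_pullback.
  move/rat_eqP: hc => hc; apply/rat_eqP.
  by apply: genericallyW (genericallyI gX iX hc e) => x [-> ->].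
- move=> c rc /rat_eqP h0 i.
  have rc' j : local_ring setT (c j \o g') by exact: local_ring_pullback.
  have /(pullback_rat_eq dg)/rat_eqP hz : rat_eq (c i \o g') (fun=> 0).
    apply: (fr (fun i => c i \o g') rc').
    apply/rat_eqP; have /rat_eqP e' := pullback_rat_eq dh gg'.
    apply: genericallyW (genericallyI gX iX h0 (genericallyI gX iX e e')).
    move=> x [h0x [ex /= e1]]; rewrite -[RHS]h0x; apply: eq_bigr => j _.
    by rewrite /= ex /= e1.
  move/rat_eqP: gg' => gg'; apply/rat_eqP.
  by apply: genericallyW (genericallyI gV iV gg' hz) => v /= [-> ->].
Qed.

End Degree.

(** If the field K(X) has the same finite degree over h^* K(V) and over its
    subfield w^* K(Z), these fields coincide.  A basis e' over the small field
    spans over the large one, hence is a basis there; expanding phi e'_0 in it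
    with coefficients in the small field gives phi as one of these.  Linear
    algebra over the function fields is done on matrices of values at generic
    points. *)
Lemma pullback_surjective (K : closedFieldType) (X V Z : space K)
    (h : X -> V) (c : V -> Z) (w : X -> Z) d :
  geometric X -> irreducible X -> geometric V -> irreducible V ->
  geometric Z -> irreducible Z ->
  dominant_rational h -> dominant_rational c -> rat_eq w (c \o h) ->
  degree h d -> degree w d ->
  forall phi : V -> K, local_ring setT phi ->
    exists2 psi : Z -> K, local_ring setT psi & rat_eq phi (psi \o c).
Proof.
move=> gX iX gV iV gZ iZ dh dc /rat_eqP hw [e [re spe fre]] [e' [re' spe' fre']].
move=> phi rphi.
(* d is positive, since the empty family does not span 1. *)
have [j0] : exists j0 : 'I_d, True.
  case: d e re spe fre e' re' spe' fre' => [|d] e re spe fre e' re' spe' fre'.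
    have [c1 [_ /rat_eqP /generically_ex [x]]] := spe _ (local_ring_cst gX iX 1).
    by rewrite big_ord0 => /eqP; rewrite oner_eq0.
  by exists ord0.
move=> _.
have spC (chi : X -> K) : local_ring setT chi -> exists C : 'I_d -> Z -> K,
    (forall j, local_ring setT (C j)) /\
    generically (fun x => chi x = \sum_j C j (c (h x)) * e' j x).
  move=> /spe' [C [rC /rat_eqP hC]]; exists C; split=> //.
  by apply: genericallyW (genericallyI gX iX hC hw) => x [-> ->].
have /boolp.choice [a0 ha] := fun i => spC _ (re i).
have /boolp.choice [B hB] : forall j, exists B : 'I_d -> V -> K,
    (forall i, local_ring setT (B i)) /\
    generically (fun x => e' j x = \sum_i B i (h x) * e i x).
  by move=> j; have [B [rB /rat_eqP hB]] := spe _ (re' j); exists B.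
pose A i j v := a0 i j (c v).
have rA i j : local_ring setT (A i j).
  by apply: (local_ring_pullback gV iV gZ dc); case: (ha i).
have rB j i : local_ring setT (B j i) by case: (hB j).
have eA : generically (fun x => forall i, e i x = \sum_j A i j (h x) * e' j x).
  by apply: (generically_ord gX iX) => i; case: (ha i).
have eB : generically (fun x => forall j, e' j x = \sum_i B j i (h x) * e i x).
  by apply: (generically_ord gX iX) => j; case: (hB j).
have AB : generically (fun v =>
    forall i k, \sum_j A i j v * B j k v = (i == k)%:R).
  apply: (generically_ord gV iV) => i; apply: (generically_ord gV iV) => k.
  have := fre (fun k v => \sum_j A i j v * B j k v - (i == k)%:R) _ _ k.
  move=> /(_ _ _)/rat_eqP H; apply: genericallyW (H _ _) => [v /eqP||].
  - by rewrite subr_eq0 => /eqP.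
  - move=> k'; apply: local_ring_sub => //; last exact: local_ring_cst.
    by apply: local_ring_sum => // j; exact: local_ring_mul.
  apply/rat_eqP; apply: genericallyW (genericallyI gX iX eA eB) => x [hA hB'].
  under eq_bigr do rewrite mulrBl mulr_suml.
  have dl : \sum_k' (i == k')%:R * e k' x = e i x.
    rewrite (bigD1 i) //= eqxx mul1r big1 ?addr0 // => k' /negbTE.
    by rewrite eq_sym => ->; rewrite mul0r.
  apply/eqP; rewrite sumrB subr_eq0 exchange_big /= dl hA; apply/eqP; apply: eq_bigr => j _.
  by rewrite hB' mulr_sumr; apply: eq_bigr => k' _; rewrite mulrA.
have BA : generically (fun v =>
    forall j k, \sum_i B j i v * A i k v = (j == k)%:R).
  apply: genericallyW AB => v hv j k.
  have : (\matrix_(i, j) A i j v) *m (\matrix_(i, j) B i j v) = 1%:M.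
    by apply/matrixP => i k'; rewrite !mxE -hv; apply: eq_bigr => l _; rewrite !mxE.
  move/mulmx1C/matrixP/(_ j k); rewrite !mxE => <-.
  by apply: eq_bigr => l _; rewrite !mxE.
have rphih : local_ring setT (phi \o h) by exact: local_ring_pullback.
have [C [rC hC]] := spC _ (local_ring_mul gX iX rphih (re' j0)).
(* D collects the coordinates on e' of phi e'_j0 - phi e'_j0 = 0, those of the
   first term lying in the small field. *)
pose D j v := C j (c v) - (j == j0)%:R * phi v.
have DB : generically (fun v => forall i, \sum_j D j v * B j i v = 0).
  apply: (generically_ord gV iV) => i.
  have := fre (fun i v => \sum_j D j v * B j i v) _ _ i.
  move=> /(_ _ _)/rat_eqP; apply.
  - move=> i'; apply: local_ring_sum => // j; apply: local_ring_mul => //.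
    apply: local_ring_sub => //; first exact: local_ring_pullback.
    by apply: local_ring_mul => //; exact: local_ring_cst.
  apply/rat_eqP; apply: genericallyW (genericallyI gX iX hC eB) => x [hx hB'].
  under eq_bigr do rewrite mulr_suml.
  rewrite exchange_big /=.
  under eq_bigr => j _.
    under eq_bigr do rewrite -mulrA.
    rewrite -mulr_sumr -hB' /D mulrBl; over.
  rewrite sumrB -hx (bigD1 j0) //= eqxx mul1r big1 ?addr0 ?subrr //.
  by move=> j /negbTE ->; rewrite !mul0r.
exists (C j0) => //; apply/rat_eqP.
apply: genericallyW (genericallyI gV iV DB BA) => v [h1 h2] /=.
have : D j0 v = 0; last first.
  by rewrite /D eqxx mul1r => /eqP; rewrite subr_eq0 => /eqP.
transitivity (\sum_j D j v * (j == j0)%:R).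
  rewrite (bigD1 j0) //= eqxx mulr1 big1 ?addr0 //.
  by move=> j /negbTE ->; rewrite mulr0.
under eq_bigr do rewrite -h2 mulr_sumr.
rewrite exchange_big /= big1 // => i _.
by under eq_bigr do rewrite mulrA; rewrite -mulr_suml h1 mul0r.
Qed.

(** * Hilbert's basis theorem *)

(** Equivalent to the ascending chain condition, in the form consumed by Krull's
    intersection theorem below: no sequence leaves, at each step, the ideal
    generated by its previous terms. *)
Definition noetherian (A : comNzRingType) := forall u : nat -> A,
  exists (k : nat) (c : nat -> A), u k = \sum_(i < k) c i * u i.

Lemma field_noetherian (F : fieldType) : noetherian F.
Proof.
move=> u; have [u0|u0] := eqVneq (u 0%N) 0.
  by exists 0%N, (fun=> 0); rewrite big_ord0.
by exists 1%N, (fun=> u 1%N / u 0%N); rewrite big_ord1 divfK.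
Qed.

Lemma noetherian_quotient (A B : comNzRingType) (f : {rmorphism A -> B}) :
  (forall b, exists a, f a = b) -> noetherian A -> noetherian B.
Proof.
move=> sf nA u; have [v hv] := boolp.choice (fun k => sf (u k)).
have [k [c e]] := nA v; exists k, (f \o c); rewrite -hv e rmorph_sum.
by apply: eq_bigr => i _; rewrite rmorphM hv.
Qed.

Section HilbertBasis.
Context (A : comNzRingType).
Implicit Types (p q : {poly A}) (s : seq {poly A}).

Definition ideal_of s p :=
  exists c : nat -> {poly A}, p = \sum_(i < size s) c i * s`_i.

Lemma ideal_of0 s : ideal_of s 0.
Proof. by exists (fun=> 0); rewrite big1 // => i _; rewrite mul0r. Qed.

Lemma ideal_ofD s p q : ideal_of s p -> ideal_of s q -> ideal_of s (p + q).
Proof.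
move=> [c ->] [d ->]; exists (fun i => c i + d i).
by rewrite -big_split; apply: eq_bigr => i _; rewrite mulrDl.
Qed.

Lemma ideal_ofM s p q : ideal_of s p -> ideal_of s (q * p).
Proof.
move=> [c ->]; exists (fun i => q * c i).
by rewrite mulr_sumr; apply: eq_bigr => i _; rewrite mulrA.
Qed.

Lemma ideal_of_sum s n (F : 'I_n -> {poly A}) : (forall i, ideal_of s (F i)) ->
  ideal_of s (\sum_(i < n) F i).
Proof. by move=> h; elim/big_rec: _ => [|i p _]; [exact: ideal_of0|exact: ideal_ofD]. Qed.

Lemma ideal_of_nth s i : (i < size s)%N -> ideal_of s s`_i.
Proof.
move=> hi; exists (fun j => (j == i)%:R).
rewrite (bigD1 (Ordinal hi)) //= eqxx mul1r big1 ?addr0 // => j.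
by rewrite -val_eqE /= => /negbTE ->; rewrite mul0r.
Qed.

Lemma ideal_of_trans s s' p : (forall i, (i < size s)%N -> ideal_of s' s`_i) ->
  ideal_of s p -> ideal_of s' p.
Proof. by move=> h [c ->]; apply: ideal_of_sum => i; apply: ideal_ofM; exact: h. Qed.

Lemma ideal_of_mkseq (u : nat -> {poly A}) k k' p : (k <= k')%N ->
  ideal_of (mkseq u k) p -> ideal_of (mkseq u k') p.
Proof.
move=> kk'; apply: ideal_of_trans => i; rewrite size_mkseq => ik.
have ik' := leq_trans ik kk'.
by rewrite nth_mkseq // -(nth_mkseq 0 u ik'); apply: ideal_of_nth; rewrite size_mkseq.
Qed.

(** Given a sequence u violating the conclusion, choose successively f_k of
    minimal degree in the ideal I of u outside the ideal of f_0, ..., f_(k-1).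
    Some leading coefficient is a combination of the previous ones, and
    cancelling it contradicts minimality. *)
Theorem poly_noetherian : noetherian A -> noetherian {poly A}.
Proof.
move=> nA u; apply: contrapT => hu.
have nu k : ~ ideal_of (mkseq u k) (u k).
  move=> [c e]; apply: hu; exists k, c; rewrite e size_mkseq.
  by apply: eq_bigr => i _; rewrite nth_mkseq.
pose I p := exists k, ideal_of (mkseq u k) p.
have Iu k : I (u k).
  exists k.+1; rewrite -(nth_mkseq 0 u (ltnSn k)).
  by apply: ideal_of_nth; rewrite size_mkseq.
have IM p q : I p -> I (q * p) by move=> [k h]; exists k; exact: ideal_ofM.
have ID p q : I p -> I q -> I (p + q).
  move=> [k h] [k' h']; exists (maxn k k').
  by apply: ideal_ofD; [apply: ideal_of_mkseq h; exact: leq_maxl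
    |apply: ideal_of_mkseq h'; exact: leq_maxr].
have I0 : I 0 by exists 0%N; exact: ideal_of0.
(* No finite part of I generates I: it would lie in the ideal of finitely many
   u_i, and so would the next one. *)
have nfg s : (forall i, (i < size s)%N -> I s`_i) -> exists p, I p /\ ~ ideal_of s p.
  move=> Is; apply: contrapT => h.
  have [k hk] : exists k, forall i, (i < size s)%N -> ideal_of (mkseq u k) s`_i.
    elim: s Is {h} => [|p s IH] Is; first by exists 0%N.
    have [k hk] := IH (fun i hi => Is i.+1 hi); have [k' hk'] := Is 0%N isT.
    exists (maxn k k'); case=> [_|i hi] /=.
      by apply: ideal_of_mkseq hk'; exact: leq_maxr.
    by apply: ideal_of_mkseq (hk _ hi); exact: leq_maxl.
  apply: (nu k); apply: (ideal_of_trans hk).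
  by apply: contrapT => h'; apply: h; exists (u k).
have /boolp.choice [pick hpick] : forall s, exists p,
    (forall i, (i < size s)%N -> I s`_i) -> [/\ I p, ~ ideal_of s p &
    forall q, I q -> ~ ideal_of s q -> (size p <= size q)%N].
  move=> s.
  case: (pselect (forall i, (i < size s)%N -> I s`_i)) => [Is|]; last by exists 0.
  have [p0 [Ip0 np0]] := nfg s Is.
  pose Q n := `[< exists p, [/\ I p, ~ ideal_of s p & size p = n] >].
  have exQ : exists n, Q n by exists (size p0); apply/asboolP; exists p0.
  case: (ex_minnP exQ) => n /asboolP [p [Ip np sp]] hmin.
  exists p => _; split=> // q Iq nq; rewrite sp; apply: hmin.
  by apply/asboolP; exists q.
(* F k is the list of the first k choices, on which the next one depends. *)
pose F := fix F k := if k is k'.+1 then rcons (F k') (pick (F k')) else [::].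
pose f k := pick (F k).
have FE k : F k = mkseq f k.
  by elim: k => // k IH; rewrite mkseqS -IH.
have If k : I (f k).
  have [m] := ubnP k; elim: m k => // m IH k /ltnSE km.
  have [] := hpick (F k); rewrite // FE => i; rewrite size_mkseq => ik.
  by rewrite nth_mkseq //; apply: IH; exact: leq_trans ik km.
have IF k i : (i < size (F k))%N -> I (F k)`_i.
  by rewrite FE size_mkseq => ik; rewrite nth_mkseq.
have nf k : ~ ideal_of (mkseq f k) (f k).
  by rewrite -FE; case: (hpick (F k) (IF k)).
have minf k q : I q -> ~ ideal_of (mkseq f k) q -> (size (f k) <= size q)%N.
  by rewrite -FE; case: (hpick (F k) (IF k)) => _ _; apply.
have sf i k : (i < k)%N -> (size (f i) <= size (f k))%N.
  move=> ik; apply: minf => // h; apply: (nf k).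
  by apply: ideal_of_mkseq h; exact: ltnW.
have f0 k : (0 < size (f k))%N.
  rewrite size_poly_gt0; apply/eqP => e; apply: (nf k); rewrite e.
  exact: ideal_of0.
have [k [c hc]] := nA (fun k => lead_coef (f k)).
pose r := \sum_(i < k) ((c i)%:P * 'X^(size (f k) - size (f i))) * f i.
have rin : ideal_of (mkseq f k) r.
  apply: ideal_of_sum => i; apply: ideal_ofM.
  by rewrite -(nth_mkseq 0 f (ltn_ord i)); apply: ideal_of_nth; rewrite size_mkseq.
have Ir : I r.
  by rewrite /r; elim/big_rec: _ => // i p _ Ip; apply: ID => //; exact: IM.
have : (size (f k - r)%R < size (f k))%N.
  rewrite -[X in (_ < X)%N](prednK (f0 k)) ltnS; apply/leq_sizeP => j.
  rewrite leq_eqVlt coefB coef_sum => /orP [/eqP <-|hj].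
    rewrite -/(lead_coef (f k)) hc -sumrB big1 // => i _.
    rewrite -mulrA coefCM coefXnM.
    have sik := sf _ _ (ltn_ord i); have i0 := f0 i; have k0 := f0 k.
    rewrite ifN; last first.
      rewrite -leqNgt; move: (size _) (size _) sik i0 k0 => [|a] [|b] //= h _ _.
      by rewrite subSS leq_subr.
    have -> : ((size (f k)).-1 - (size (f k) - size (f i)) = (size (f i)).-1)%N.
      move: sik i0 k0; case: (size (f k)) => [|a] //; case: (size (f i)) => [|b] //= h _ _.
      by rewrite subSS subKn.
    by rewrite subrr.
  have kj : (size (f k) <= j)%N by move: hj (f0 k); case: (size (f k)).
  rewrite nth_default // sub0r big1 ?oppr0 // => i _.
  rewrite -mulrA coefCM coefXnM; case: ifP => _; first by rewrite mulr0.
  rewrite nth_default ?mulr0 //.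
  by rewrite leq_subRL ?subnK ?(leq_trans (leq_subr _ _) kj) ?sf.
rewrite ltnNge => /negP; apply; apply: minf.
  by apply: ID => //; rewrite -mulN1r; exact: IM.
move=> h; apply: (nf k); rewrite -[f k](subrK r).
exact: ideal_ofD.
Qed.

End HilbertBasis.

Lemma mpoly_alg_ind (n : nat) (A : comNzRingType) (P : {mpoly A[n]} -> Prop) :
  (forall c, P c%:MP) -> (forall i, P 'X_i) ->
  (forall p q, P p -> P q -> P (p + q)) -> (forall p q, P p -> P q -> P (p * q)) ->
  forall p, P p.
Proof.
move=> PC PX PD PM p; rewrite [p]mpolyE.
elim/big_rec: _ => [|m q _ Pq]; first by rewrite -mpolyC0.
apply: (PD) => //; rewrite -mul_mpolyC; apply: (PM) => //; rewrite mpolyXE_id.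
elim/big_rec: _ => [|i r _ Pr]; first by rewrite -mpolyC1.
apply: (PM) => //; elim: (m i) => [|k IH]; first by rewrite expr0 -mpolyC1.
by rewrite exprS; exact: PM.
Qed.

(** A polynomial ring in n.+1 variables is a quotient of polynomials in one
    variable over polynomials in n variables. *)
Theorem mpoly_noetherian (F : fieldType) n : noetherian {mpoly F[n]}.
Proof.
elim: n => [|n IH].
  apply: (noetherian_quotient (f := @mpolyC 0 F) _ (@field_noetherian F)) => p.
  by exists p@_0%MM; apply/esym/nvar0_mpolyC_eq.
pose f : {rmorphism {poly {mpoly F[n]}} -> {mpoly F[n.+1]}} :=
  horner_eval 'X_(@ord_max n) \o map_poly (@mwiden n F).
apply: (noetherian_quotient (f := f) _ (poly_noetherian IH)) => p.
elim/mpoly_alg_ind: p => [c|i|p q [a <-] [b <-]|p q [a <-] [b <-]].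
- exists c%:MP%:P; rewrite /f /= /horner_eval map_polyC hornerC; exact: mwidenC.
- case: (unliftP ord_max i) => [j|] ->.
    exists ('X_j)%:P; rewrite /f /= /horner_eval map_polyC hornerC /= mwidenX mnmwiden1.
    by congr 'X_[U_(_)]; apply: val_inj => /=; rewrite /bump leqNgt ltn_ord.
  by exists 'X; rewrite /f /= /horner_eval map_polyX hornerX.
- by exists (a + b); rewrite rmorphD.
- by exists (a * b); rewrite rmorphM.
Qed.

(** * The local ring of a smooth curve at a point *)

Section RegularMatrix.
Context (K : closedFieldType) (X : space K) (gX : geometric X).

Lemma regular_det n (F : X -> 'M[K]_n) x :
  (forall i j, regular_at x (fun y => F y i j)) -> regular_at x (fun y => \det (F y)).
Proof.
move=> h; rewrite /determinant; apply: (reg_sum gX) => s _.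
by apply: (reg_mul gX); [exact: reg_cst|apply: (reg_prod gX)].
Qed.

Lemma regular_adj n (F : X -> 'M[K]_n) x :
  (forall i j, regular_at x (fun y => F y i j)) ->
  forall i j, regular_at x (fun y => (\adj (F y)) i j).
Proof.
move=> h i j; under eq_fun do rewrite mxE /cofactor.
apply: (reg_mul gX); first exact: reg_cst.
by apply: regular_det => k l; under eq_fun do rewrite !mxE.
Qed.

End RegularMatrix.

Section LocalRing.
Context (K : closedFieldType) (N : nat) (A : set (proj_space K N)).
Local Notation T := (sub_space A).
Context (irr : irreducible T) (t0 : T).

Let gP := proj_geometric K N.
Let gT : geometric T := sub_geometric A gP.

Context (i0 : 'I_N.+1) (i0P : hcoord (\val t0 : proj_space K N) i0 != 0).

(** Affine coordinates of the chart around t0. All N.+1 ratios are kept, the one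
    of index i0 being constant. *)
Definition affine_coord (t : T) : 'I_N.+1 -> K := fun j => coord_ratio i0 j (\val t).
Local Notation y := affine_coord.
Implicit Types (phi psi a b u : T -> K) (p q : {mpoly K[N.+1]}).

Lemma regular_affine (t : T) p : hcoord (\val t : proj_space K N) i0 != 0 ->
  regular_at t (fun t : T => p.@[y t]).
Proof.
move=> ti; apply: (@reg_meval _ _ gT _ p (fun j t => y t j)) => j.
have [_ _ r] := morphism_val gP A.
exact: (r t (coord_ratio i0 j) I (regular_coord j ti)).
Qed.

Lemma chart_open : is_open T [set t : T | hcoord (\val t : proj_space K N) i0 != 0].
Proof. by exists [set x | hcoord x i0 != 0] => //; exact: hcoord_open. Qed.

Lemma meval_affine (t : T) p d : hcoord (\val t : proj_space K N) i0 != 0 ->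
  p \is d.-homog ->
  p.@[hcoord (\val t : proj_space K N)] =
  hcoord (\val t : proj_space K N) i0 ^+ d * p.@[y t].
Proof.
move=> ti hp; rewrite -(meval_homog _ _ hp); apply: meval_eq => j.
by rewrite /y /coord_ratio mulrC divfK.
Qed.

(** The local ring at t is a localization of the image of a polynomial ring; the
    polynomials here need not be homogeneous. *)
Lemma regular_affine_frac (t : T) phi : hcoord (\val t : proj_space K N) i0 != 0 ->
  regular_at t phi -> exists p q, q.@[y t] != 0 /\
  near_point t (fun t : T => phi t = p.@[y t] / q.@[y t]).
Proof.
move=> ti [psi /proj_regP [d [p [q [hp hq qt hpsi]]]] hphi].
exists p, q; split.
  by move: qt; rewrite (meval_affine ti hq) mulf_eq0 negb_or => /andP [].
have := nearI gT hphi (nearI gT (near_open chart_open ti)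
  (morphism_near (morphism_val gP A) (I : setT t) hpsi)).
apply: nearW => {qt}t' [-> [t'i ->]].
rewrite (meval_affine t'i hp) (meval_affine t'i hq) -mulf_div divff ?mul1r //.
by rewrite expf_neq0.
Qed.

Lemma rational_affine_frac phi : local_ring setT phi ->
  exists p q, generically (fun t : T => q.@[y t] != 0) /\
  generically (fun t => phi t = p.@[y t] / q.@[y t]).
Proof.
move=> /(generically_reg gT) r.
have gc : generically (fun t : T => hcoord (\val t : proj_space K N) i0 != 0).
  exact: generically_near (near_open chart_open i0P).
have [t [ti rt]] := generically_ex (genericallyI gT irr gc r).
have [p [q [qt h]]] := regular_affine_frac ti rt; exists p, q.
split; last exact: generically_near h.
exact: (generically_near (reg_neq0 gT (regular_affine q ti) qt)).
Qed.

Lemma vanishing_affine p : exists a : 'I_N.+1 -> T -> K,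
  (forall j, regular_at t0 (a j)) /\
  forall t, p.@[y t] - p.@[y t0] = \sum_j (y t j - y t0 j) * a j t.
Proof.
elim/mpoly_alg_ind: p => [c|i|p q [a [ra ea]] [b [rb eb]]|p q [a [ra ea]] [b [rb eb]]].
- exists (fun _ _ => 0); split=> [j|t]; first exact: reg_cst.
  by rewrite !mevalC subrr big1 // => j _; rewrite mulr0.
- exists (fun j _ => (j == i)%:R); split=> [j|t]; first exact: reg_cst.
  rewrite !mevalXU (bigD1 i) //= eqxx mulr1 big1 ?addr0 // => j /negbTE ->.
  by rewrite mulr0.
- exists (fun j t => a j t + b j t); split=> [j|t]; first exact: reg_add.
  rewrite !mevalD opprD addrACA ea eb -big_split /=.
  by apply: eq_bigr => j _; rewrite mulrDr.
- exists (fun j t => a j t * q.@[y t] + p.@[y t0] * b j t); split=> [j|t].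
    apply: (reg_add gT); apply: (reg_mul gT) => //; last exact: reg_cst.
    exact: regular_affine.
  rewrite !mevalM; transitivity ((p.@[y t] - p.@[y t0]) * q.@[y t] +
    p.@[y t0] * (q.@[y t] - q.@[y t0])).
    by rewrite mulrBl mulrBr addrA subrK.
  rewrite ea eb mulr_suml mulr_sumr -big_split /=.
  by apply: eq_bigr => j _; rewrite mulrDr mulrA mulrCA.
Qed.

Lemma max_ideal_affine phi : max_ideal t0 phi -> exists a : 'I_N.+1 -> T -> K,
  (forall j, regular_at t0 (a j)) /\
  near_point t0 (fun t : T => phi t = \sum_j (y t j - y t0 j) * a j t).
Proof.
move=> [r p0]; have [p [q [qt h]]] := regular_affine_frac i0P r.
have [a [ra ea]] := vanishing_affine p.
exists (fun j t => a j t / q.@[y t]); split.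
  by move=> j; apply: reg_div => //; exact: regular_affine.
have pt0 : p.@[y t0] = 0.
  have /eqP := near_self h; rewrite p0 eq_sym mulf_eq0 invr_eq0 (negbTE qt) orbF.
  by move/eqP.
apply: nearW h => t ->; have := ea t; rewrite pt0 subr0 => ->; rewrite mulr_suml.
by apply: eq_bigr => j _; rewrite mulrA.
Qed.

(** Nakayama's lemma: the affine coordinates z_j (centred at t0) generate the
    maximal ideal, and z = s c + M z with M vanishing at t0, so Cramer's rule
    gives z in terms of s. *)
Lemma max_ideal_principal : cotangent_dim t0 1 -> exists s : T -> K,
  [/\ max_ideal t0 s, ~ rat_eq s (fun=> 0) &
  forall phi, max_ideal t0 phi -> exists2 psi, regular_at t0 psi &
    near_point t0 (fun t : T => phi t = s t * psi t)].
Proof.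
move=> [s' [hs hc]]; pose s := s' ord0; have ms : max_ideal t0 s := hs ord0.
have rs : regular_at t0 s := ms.1.
pose z j t := y t j - y t0 j.
have mz j : max_ideal t0 (z j).
  split; last by rewrite /z subrr.
  apply: (reg_sub gT); last exact: reg_cst.
  have := regular_affine 'X_j i0P.
  by under eq_fun do rewrite mevalXU.
have /boolp.choice [cM hcM] : forall j, exists cM : K * ('I_N.+1 -> T -> K),
    (forall l, max_ideal t0 (cM.2 l)) /\
    near_point t0 (fun t : T => z j t = s t * cM.1 + \sum_l cM.2 l t * z l t).
  move=> j; have [c [[r [a [b [mab hab]]]] _]] := hc _ (mz j).
  have /boolp.choice [al hal] := fun i => max_ideal_affine (mab i).1.
  exists (c ord0 ord0, fun l t => \sum_(i < r) al i l t * b i t); split=> [l|/=].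
    split=> /=; last by rewrite big1 // => i _; rewrite (mab i).2.2 mulr0.
    apply: (reg_sum gT) => i _; apply: (reg_mul gT); last exact: (mab i).2.1.
    by case: (hal i).
  have h := near_ord gT (fun i => (hal i).2).
  apply: nearW (nearI gT hab h) => t [+ ht]; rewrite big_ord1 => /eqP.
  rewrite subr_eq => /eqP ->; rewrite addrC; congr (_ + _); first by rewrite mulrC.
  under [LHS]eq_bigr do rewrite ht mulr_suml.
  rewrite exchange_big /=; apply: eq_bigr => l _; rewrite mulr_suml.
  by apply: eq_bigr => i _; rewrite -mulrA mulrC.
pose M t := \matrix_(j, l) (cM j).2 l t.
pose c := \col_j (cM j).1.
have rM : forall j l, regular_at t0 (fun t => (1%:M - M t) j l).
  move=> j l; under eq_fun do rewrite !mxE.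
  by apply: (reg_sub gT); [exact: reg_cst|case: ((hcM j).1 l)].
have rdet := regular_det gT rM.
have det0 : \det (1%:M - M t0) != 0.
  suff -> : M t0 = 0 by rewrite subr0 det1 oner_neq0.
  by apply/matrixP => j l; rewrite !mxE; case: ((hcM j).1 l).
pose rho j t := (\sum_l (\adj (1%:M - M t)) j l * c l ord0) / \det (1%:M - M t).
have rrho j : regular_at t0 (rho j).
  apply: (reg_div gT) => //; apply: (reg_sum gT) => l _.
  by apply: (reg_mul gT); [exact: regular_adj|exact: reg_cst].
have hz : near_point t0 (fun t : T => forall j, z j t = s t * rho j t).
  have := nearI gT (near_ord gT (fun j => (hcM j).2)) (reg_neq0 gT rdet det0).
  apply: nearW => t [ht dt] j.
  pose Z := \col_j z j t.
  have e : (1%:M - M t) *m Z = s t *: c.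
    apply/colP => k; rewrite mulmxBl mul1mx !mxE {1}ht.
    apply/eqP; rewrite subr_eq; apply/eqP; congr (_ + _).
    by apply: eq_bigr => l _; rewrite !mxE.
  have := congr1 (mulmx (\adj (1%:M - M t))) e.
  rewrite mulmxA mul_adj_mx mul_scalar_mx -scalemxAr => /colP/(_ j).
  rewrite !mxE => e2; apply: (mulfI dt).
  by rewrite e2 mulrCA [X in _ = _ * X]mulrCA divff // mulr1.
exists s; split=> //; last first.
  move=> phi /max_ideal_affine [a [ra ha]].
  exists (fun t => \sum_j rho j t * a j t).
    by apply: (reg_sum gT) => j _; exact: (reg_mul gT).
  apply: nearW (nearI gT hz ha) => t [zt ->]; rewrite mulr_sumr.
  by apply: eq_bigr => j _; rewrite mulrA -zt.
(* s = 0 would make the coefficient of a class on the basis s ambiguous. *)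
move=> s0; have {}s0 := near0_generic gT irr rs s0.
have [] := hc (fun=> 0); first by split=> //; exact: reg_cst.
move=> c0 [_ uc].
have any (k : 'rV[K]_1) : max_ideal_sq t0
    (fun t => 0 - \sum_(i < 1) k ord0 i * s' i t).
  exists 0%N, (fun _ _ => 0), (fun _ _ => 0); split; first by case.
  apply: nearW s0 => t st.
  by rewrite big_ord1 -/s st mulr0 subr0 big_ord0.
have /matrixP/(_ ord0 ord0) := etrans (esym (uc _ (any 0))) (uc _ (any (const_mx 1))).
by rewrite !mxE => /esym/eqP; rewrite oner_eq0.
Qed.

Context (smooth : cotangent_dim t0 1).

(** Krull's intersection theorem: if phi were divisible by every power of s,
    the quotients a_k would form a sequence in a noetherian ring with
    a_j = s^(k-j) a_k, and a relation expressing a_k by the previous ones would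
    read a_k (unit) = 0. *)
Lemma order_of_vanishing s phi : max_ideal t0 s ->
  (forall phi, max_ideal t0 phi -> exists2 psi, regular_at t0 psi &
    near_point t0 (fun t : T => phi t = s t * psi t)) ->
  regular_at t0 phi -> ~ rat_eq phi (fun=> 0) ->
  exists k u, [/\ regular_at t0 u, u t0 != 0 &
    near_point t0 (fun t : T => phi t = s t ^+ k * u t)].
Proof.
move=> [rs s0] div rphi nz; apply: contrapT => H.
have /boolp.choice [F hF] : forall a, exists b, max_ideal t0 a ->
    regular_at t0 b /\ near_point t0 (fun t : T => a t = s t * b t).
  move=> a; case: (pselect (max_ideal t0 a)) => [/div [b rb hb]|na]; first by exists b.
  by exists a.
pose a k := iter k F phi.
have ha k : max_ideal t0 (a k) /\ near_point t0 (fun t : T => phi t = s t ^+ k * a k t).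
  elim: k => [|k [ma ea]].
    split; last by apply: (nearT gT) => t; rewrite expr0 mul1r.
    split=> //; apply/eqP/negPn/negP => n0; apply: H; exists 0%N, phi; split=> //.
    by apply: (nearT gT) => t; rewrite expr0 mul1r.
  have [rF eF] := hF _ ma.
  have e : near_point t0 (fun t : T => phi t = s t ^+ k.+1 * a k.+1 t).
    apply: nearW (nearI gT ea eF) => t [-> ->].
    by rewrite exprSr mulrA.
  split=> //; split=> //; apply/eqP/negPn/negP => n0; apply: H.
  by exists k.+1, (a k.+1).
have aj j k : (j <= k)%N -> near_point t0 (fun t : T => a j t = s t ^+ (k - j) * a k t).
  elim: k => [|k IH].
    by rewrite leqn0 => /eqP ->; apply: (nearT gT) => t; rewrite expr0 mul1r.
  rewrite leq_eqVlt => /predU1P [->|].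
    by apply: (nearT gT) => t; rewrite subnn expr0 mul1r.
  move=> /ltnSE jk; have [_ eF] := hF _ (ha k).1.
  apply: nearW (nearI gT (IH jk) eF) => t [-> ->].
  by rewrite subSn // exprSr mulrA.
have /boolp.choice [pq hpq] : forall k, exists pq : {mpoly K[N.+1]} * {mpoly K[N.+1]},
    pq.2.@[y t0] != 0 /\ near_point t0 (fun t : T => a k t = pq.1.@[y t] / pq.2.@[y t]).
  move=> k; have [p [q hpq]] := regular_affine_frac i0P (ha k).1.1.
  by exists (p, q).
have [k [c ek]] := @mpoly_noetherian K N.+1 (fun k => (pq k).1).
(* The relation p_k = \sum_(i < k) c_i p_i, rewritten with p_i = a_i q_i and
   a_i = s^(k-i) a_k, says a_k w = 0. *)
pose w t := (pq k).2.@[y t] - \sum_(i < k) (c i).@[y t] * (pq i).2.@[y t] * s t ^+ (k - i).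
have rw : regular_at t0 w.
  apply: (reg_sub gT); first exact: regular_affine.
  apply: (reg_sum gT) => i _; apply: (reg_mul gT); last exact: reg_exp.
  by apply: (reg_mul gT); exact: regular_affine.
have w0 : w t0 != 0.
  rewrite /w big1 ?subr0; first by case: (hpq k).
  by move=> i _; rewrite s0 expr0n subn_eq0 leqNgt ltn_ord mulr0.
apply: nz; apply/rat_eqP.
have pqN j : near_point t0 (fun t : T => a j t * (pq j).2.@[y t] = (pq j).1.@[y t]).
  have [q0 hj] := hpq j.
  have := nearI gT hj (reg_neq0 gT (regular_affine (pq j).2 i0P) q0).
  by apply: nearW => t [-> qt]; rewrite divfK.
have h1 := near_ord gT (fun i : 'I_k => pqN i).
have h2 := near_ord gT (fun i : 'I_k => aj i k (ltnW (ltn_ord i))).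
have := nearI gT (pqN k) (nearI gT h1 (nearI gT h2
  (nearI gT (ha k).2 (reg_neq0 gT rw w0)))).
move/generically_near; apply: genericallyW => t [e [e1 [e2 [-> wt]]]].
suff /eqP : a k t * w t = 0.
  by rewrite mulf_eq0 (negbTE wt) orbF => /eqP ->; rewrite mulr0.
rewrite /w mulrBr e ek rmorph_sum /= mulr_sumr -sumrB big1 // => i _.
rewrite rmorphM /= -e1 e2; apply/eqP; rewrite subr_eq0; apply/eqP.
by rewrite -!mulrA [RHS]mulrCA [X in _ * X = _]mulrC -!mulrA.
Qed.
End LocalRing.

Section Valuation.
Context (K : closedFieldType) (N : nat) (A : set (proj_space K N)).
Local Notation T := (sub_space A).
Context (irr : irreducible T) (t0 : T) (smooth : cotangent_dim t0 1).

Let gT : geometric T := sub_geometric A (proj_geometric K N).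

(** Divisibility in K(T) with respect to the local ring at t0. *)
Definition divides (b a : T -> K) :=
  exists2 theta, regular_at t0 theta & generically (fun t => a t = b t * theta t).

Lemma divides_refl a : divides a a.
Proof.
exists (fun=> 1); first exact: reg_cst.
apply: (generically_near (x := t0)); apply: (nearT gT) => t.
by rewrite mulr1.
Qed.

Lemma divides_trans a b c : divides a b -> divides b c -> divides a c.
Proof.
move=> [u ru hu] [v rv hv]; exists (fun t => u t * v t); first exact: reg_mul.
by apply: genericallyW (genericallyI gT irr hu hv) => t [-> ->]; rewrite mulrA.
Qed.

(** The local ring at a smooth point of a curve is a valuation ring: up to
    units, every rational function is a power of a uniformizer. *)
Lemma divides_total a b : local_ring setT a -> local_ring setT b ->
  divides a b \/ divides b a.
Proof.
have [i0 i0P] := hcoord_neq0 (\val t0 : proj_space K N).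
have [s [ms s0 div]] := max_ideal_principal irr i0P smooth.
have gs : generically (fun t => s t != 0).
  by apply: (generically_neq0 gT) => //; exists t0 => //; exact: ms.1.
have div0 (phi psi : T -> K) : rat_eq phi (fun=> 0) -> divides psi phi.
  move=> /rat_eqP e; exists (fun=> 0); first exact: reg_cst.
  by apply: genericallyW e => t ->; rewrite mulr0.
have frac (phi : T -> K) : local_ring setT phi -> ~ rat_eq phi (fun=> 0) ->
    exists k m u, [/\ regular_at t0 u, u t0 != 0 &
      generically (fun t => phi t * s t ^+ m = s t ^+ k * u t)].
  move=> rphi nz; have [p [q [nq hpq]]] := rational_affine_frac irr i0P rphi.
  have rp := regular_affine p i0P; have rq := regular_affine q i0P.
  have nzq : ~ rat_eq (fun t : T => q.@[affine_coord i0 t]) (fun=> 0).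
    move=> /rat_eqP /(genericallyI gT irr nq) /generically_ex [t [/negP + e]].
    by apply; apply/eqP.
  have nzp : ~ rat_eq (fun t : T => p.@[affine_coord i0 t]) (fun=> 0).
    move=> /rat_eqP e; apply: nz; apply/rat_eqP.
    by apply: genericallyW (genericallyI gT irr hpq e) => t [-> ->]; rewrite mul0r.
  have [k [u [ru u0 /generically_near hu]]] := order_of_vanishing i0P ms div rp nzp.
  have [m [w [rw w0 hw]]] := order_of_vanishing i0P ms div rq nzq.
  have {}hw := generically_near (nearI gT hw (reg_neq0 gT rw w0)).
  exists k, m, (fun t => u t / w t); split; first exact: reg_div.
    by rewrite mulf_neq0 // invr_eq0.
  have := genericallyI gT irr hpq (genericallyI gT irr gs (genericallyI gT irr hu hw)).
  apply: genericallyW => t [-> [st [-> [-> wt]]]].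
  by field; rewrite wt expf_neq0.
move=> ra rb; case: (pselect (rat_eq a (fun=> 0))) => [a0|na].
  by right; exact: div0.
case: (pselect (rat_eq b (fun=> 0))) => [b0|nb]; first by left; exact: div0.
have step (a' b' : T -> K) k m u k' m' u' : regular_at t0 u -> regular_at t0 u' ->
    u' t0 != 0 ->
    generically (fun t => a' t * s t ^+ m = s t ^+ k * u t) ->
    generically (fun t => b' t * s t ^+ m' = s t ^+ k' * u' t) ->
    (k' + m <= k + m')%N -> divides b' a'.
  move=> ru ru' u'0 ha hb le.
  exists (fun t => s t ^+ (k + m' - (k' + m)) * (u t / u' t)).
    apply: (reg_mul gT); last exact: reg_div.
    by apply: reg_exp => //; exact: ms.1.
  have gu' := generically_near (reg_neq0 gT ru' u'0).
  have := genericallyI gT irr gs (genericallyI gT irr gu' (genericallyI gT irr ha hb)).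
  apply: genericallyW => t [st [ut [ea eb]]].
  apply: (mulIf (expf_neq0 (m + m') st)).
  rewrite exprD mulrA ea.
  transitivity ((b' t * s t ^+ m') *
    (s t ^+ (k + m' - (k' + m)) * s t ^+ m * (u t / u' t))).
    rewrite eb; transitivity (s t ^+ (k + m' - (k' + m) + (k' + m)) * u t).
      by rewrite subnK // exprD; ring.
    by rewrite !exprD; field.
  by ring.
have [k [m [u [ru u0 hu]]]] := frac a ra na.
have [k' [m' [u' [ru' u'0 hu']]]] := frac b rb nb.
have [le|/ltnW le] := leqP (k' + m) (k + m').
  by right; exact: step hu hu' le.
by left; exact: step hu' hu le.
Qed.

Lemma divides_all (I : finType) (i1 : I) (Psi : I -> T -> K) :
  (forall i, local_ring setT (Psi i)) -> exists j, forall i, divides (Psi j) (Psi i).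
Proof.
move=> r; suff [j hj] : exists j, forall i, i \in enum I -> divides (Psi j) (Psi i).
  by exists j => i; apply: hj; rewrite mem_enum.
elim: (enum I) => [|x l [j hj]]; first by exists i1.
case: (divides_total (r j) (r x)) => h.
  by exists j => i; rewrite inE => /predU1P [->|/hj].
exists x => i; rewrite inE => /predU1P [->|/hj]; first exact: divides_refl.
exact: divides_trans.
Qed.

End Valuation.

(** * Extending a rational map across a fibre *)

Section TensorFamily.
Context (K : closedFieldType) (X Y : space K).
Context (gX : geometric X) (gY : geometric Y).

Lemma tensor_prod (I : finType) (P : pred I) (U : set X) (V : set Y)
    (F : I -> X * Y -> K) : (forall i, tensor_function U V (F i)) ->
  tensor_function U V (fun p => \prod_(i | P i) F i p).
Proof.
move=> h; have -> : (fun p => \prod_(i | P i) F i p) =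
  \big[(fun a b => fun y => a y * b y)/(fun=> 1)]_(i | P i) F i.
  by apply/funext => y; elim/big_rec2: _ => // i a b _ <-.
elim/big_rec: _ => [|i a Pi ra]; first exact: tensor_cst.
exact: tensor_mul.
Qed.

(** The functions phi can be taken linearly independent over K, by eliminating
    one of them from a relation as long as there is one. Then a combination of
    them vanishes identically only if all its coefficients do, which detects the
    vanishing of a tensor function on a slice X x y. *)
Lemma tensor_family n (U : set X) (V : set Y) (a : 'I_n -> X * Y -> K) :
  (forall j, tensor_function U V (a j)) ->
  exists (m : nat) (phi : 'I_m -> X -> K) (Psi : 'I_n -> 'I_m -> Y -> K),
    [/\ forall k x, U x -> regular_at x (phi k),
        forall j k y, V y -> regular_at y (Psi j k),
        forall j p, U p.1 -> a j p = \sum_k phi k p.1 * Psi j k p.2 &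
        forall c : 'I_m -> K, (forall x, U x -> \sum_k c k * phi k x = 0) ->
          forall k, c k = 0].
Proof.
move=> ta.
have [m [phi [Psi [h1 h2 h3]]]] : exists m (phi : 'I_m -> X -> K)
    (Psi : 'I_n -> 'I_m -> Y -> K),
    [/\ forall k x, U x -> regular_at x (phi k),
        forall j k y, V y -> regular_at y (Psi j k) &
        forall j p, U p.1 -> a j p = \sum_k phi k p.1 * Psi j k p.2].
  have /boolp.choice [D hD] : forall j,
      exists D : {m & ('I_m -> X -> K) * ('I_m -> Y -> K)}%type,
      [/\ forall k x, U x -> regular_at x ((projT2 D).1 k),
          forall k y, V y -> regular_at y ((projT2 D).2 k) &
          forall p, a j p = \sum_k (projT2 D).1 k p.1 * (projT2 D).2 k p.2].
    by move=> j; have [m [phi [psi h]]] := ta j; exists (existT _ m (phi, psi)).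
  (* one common family: the disjoint union of the families of the a_j *)
  pose I : finType := {j : 'I_n & 'I_(projT1 (D j))}.
  pose psi j (i : I) : Y -> K :=
    if tag i == j then (projT2 (D (tag i))).2 (tagged i) else fun=> 0.
  exists #|I|, (fun i => (projT2 (D (tag (enum_val i)))).1 (tagged (enum_val i))).
  exists (fun j i => psi j (enum_val i)); split.
  - by move=> k x Ux; case: (hD (tag (enum_val k))) => + _ _; exact.
  - move=> j k y Vy; rewrite /psi; case: ifP => _; last exact: reg_cst.
    by case: (hD (tag (enum_val k))) => _ + _; exact.
  move=> j p _; case: (hD j) => _ _ ->.
  transitivity (\sum_(i : I) (projT2 (D (tag i))).1 (tagged i) p.1 * psi j i p.2);
    last by rewrite (reindex _ (onW_bij _ (@enum_val_bij I))).
  rewrite -(@sig_big_dep _ _ _ _ (fun j => 'I_(projT1 (D j))) predT (fun _ => predT)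
    (fun j' k => (projT2 (D j')).1 k p.1 *
      psi j (Tagged (fun j => 'I_(projT1 (D j))) k) p.2)) /= (bigD1 j) //=.
  rewrite [X in _ + X]big1 ?addr0; last first.
    by move=> j' /negbTE nj; rewrite big1 // => k _; rewrite /psi /= nj mulr0.
  by apply: eq_bigr => k _; rewrite /psi /= eqxx.
elim: m phi Psi h1 h2 h3 => [|m IH] phi Psi h1 h2 h3.
  by exists 0%N, phi, Psi; split=> // c _ [].
case: (pselect (forall c : 'I_m.+1 -> K,
  (forall x, U x -> \sum_k c k * phi k x = 0) -> forall k, c k = 0)) => [li|].
  by exists m.+1, phi, Psi.
move=> /existsNP [c /not_implyP [hc /existsNP [k0 /eqP ck0]]].
apply: (IH (fun k => phi (lift k0 k))
  (fun j k y => Psi j (lift k0 k) y - c (lift k0 k) / c k0 * Psi j k0 y)).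
- by move=> k; exact: h1.
- move=> j k y Vy; apply: (reg_sub gY); first exact: h2.
  by apply: (reg_mul gY); [exact: reg_cst|exact: h2].
move=> j p Up; rewrite h3 // (bigD1_ord k0) //=.
have : phi k0 p.1 = - \sum_(k < m) c (lift k0 k) / c k0 * phi (lift k0 k) p.1.
  have := hc _ Up; rewrite (bigD1_ord k0) //= => /eqP; rewrite addr_eq0 => /eqP e.
  apply: (mulfI ck0); rewrite e mulrN mulr_sumr; congr (- _).
  by apply: eq_bigr => k _; rewrite mulrCA mulrA divfK // mulrC.
move=> ->; rewrite mulNr mulr_suml addrC -sumrB; apply: eq_bigr => k _.
by ring.
Qed.

End TensorFamily.

Lemma prod_slice (K : closedFieldType) (X T : space K) (t : T) :
  geometric X -> geometric T ->
  @morphism_on K X (prod_space X T) setT (fun x => (x, t)).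
Proof.
move=> gX gT; apply: morphism_pair => //; first exact: morphism_id.
exact: morphism_cst.
Qed.

Lemma generically_snd (K : closedFieldType) (X T : space K) (P : T -> Prop) :
  geometric X -> geometric T -> (exists x : X, True) -> generically P ->
  @generically K (prod_space X T) (fun p => P p.2).
Proof.
move=> gX gT [x _] [W [oW [t Wt] hW]].
apply: (generically_near (X := prod_space X T) (x := (x, t))).
have := morphism_near (morphism_snd gX gT) (I : setT (x, t)) (near_open oW Wt).
by apply: nearW => p /hW.
Qed.

Lemma generically_slice (K : closedFieldType) (X T : space K) (x : X) (t : T)
    (P : X * T -> Prop) : geometric X -> geometric T ->
  @near_point K (prod_space X T) (x, t) P -> generically (fun x => P (x, t)).
Proof.
move=> gX gT h; apply: (generically_near (x := x)).
exact: (morphism_near (prod_slice t gX gT) (I : setT x) h).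
Qed.

Section Extension.
Context (K : closedFieldType) (N : nat) (A : set (proj_space K N)).
Local Notation T := (sub_space A).
Context (irrT : irreducible T) (t0 : T) (smooth : cotangent_dim t0 1).
Context (V : space K) (gV : geometric V) (irrV : irreducible V) (Y : variety_over T).
Local Notation pi := (@structure_map K T Y).
Local Notation VT := (prod_space V T).
Local Notation M := (variety_over_dim Y).
Local Notation PT := (prod_space (proj_space K M) T).

Let gT : geometric T := sub_geometric A (proj_geometric K N).
Let gVT : geometric VT := prod_geometric gV gT.
Let irrVT : irreducible VT := prod_irreducible gV gT irrV irrT.
Let gPT : geometric PT := prod_geometric (proj_geometric K M) gT.
Let gY : geometric Y := sub_geometric (variety_over_set Y) gPT.

Let coords (y : Y) : 'I_M.+1 -> K := hcoord (\val y).1.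

(** The ratios of the homogeneous coordinates of g are regular, that is locally
    quotients of tensor functions; multiplying by a common denominator makes the
    coordinates themselves tensor functions. *)
Lemma tensor_coords (g : VT -> Y) p : (exists2 W, W p & morphism_on W g) ->
  exists (U : set V) (O : set T) (a : 'I_M.+1 -> VT -> K),
  [/\ is_open V U /\ U p.1, is_open T O /\ O p.2,
      forall j, tensor_function U O (a j) &
      near_point (p : VT) (fun q : VT => exists2 c, c != 0 &
        forall j, coords (g q) j = c * a j q)].
Proof.
move=> [W Wp mg]; have [_ _ rg] := mg.
have [i yi] := hcoord_neq0 (\val (g p)).1.
have [_ _ r1] := @morphism_val K PT gPT (variety_over_set Y).
have [_ _ r2] := morphism_fst (proj_geometric K M) gT.
have reta j : regular_at (g p) (fun y : Y => coord_ratio i j (\val y).1).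
  exact: r1 (g p) _ I (r2 (\val (g p)) _ I (regular_coord j yi)).
have /boolp.choice [D hD] : forall j,
    exists D : set V * set T * ((V * T -> K) * (V * T -> K)),
    [/\ is_open V D.1.1 /\ D.1.1 p.1, is_open T D.1.2 /\ D.1.2 p.2,
        tensor_function D.1.1 D.1.2 D.2.1, tensor_function D.1.1 D.1.2 D.2.2 &
        near_point (p : VT) (fun q : VT => D.2.2 q != 0 /\
          coord_ratio i j (\val (g q)).1 = D.2.1 q / D.2.2 q)].
  move=> j; have [U [O [a [b h]]]] := rg p _ Wp (reta j).
  by exists ((U, O), (a, b)).
have [U [oU Up sU]] : near_point p.1 (fun v => forall j, (D j).1.1 v).
  by apply: (near_ord gV) => j; case: (hD j) => [[oD Dp] _ _ _ _]; exact: near_open.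
have [O [oO Op sO]] : near_point p.2 (fun v => forall j, (D j).1.2 v).
  by apply: (near_ord gT) => j; case: (hD j) => [_ [oD Dp] _ _ _]; exact: near_open.
exists U, O, (fun j q => (D j).2.1 q * \prod_(k | k != j) (D k).2.2 q); split=> //.
  move=> j; apply: tensor_mul => //.
    case: (hD j) => [_ _ + _ _]; apply: tensorW; [by move=> v /sU|by move=> t /sO].
  apply: tensor_prod => // k.
  case: (hD k) => [_ _ _ + _]; apply: tensorW; [by move=> v /sU|by move=> t /sO].
have hi : near_point (p : VT) (fun q : VT => coord_ratio i i (\val (g q)).1 != 0).
  apply: (morphism_near mg Wp (P := fun y : Y => coord_ratio i i (\val y).1 != 0)).
  apply: (reg_neq0 gY (reta i)).
  by rewrite /coord_ratio divff ?oner_neq0.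
have hN : near_point (p : VT) (fun q : VT => forall j, (D j).2.2 q != 0 /\
    coord_ratio i j (\val (g q)).1 = (D j).2.1 q / (D j).2.2 q).
  by apply: (near_ord gVT) => j; case: (hD j).
apply: nearW (nearI gVT hi hN) => q [qi hq].
have qi' : coords (g q) i != 0.
  by apply: contraNneq qi; rewrite /coord_ratio /coords => ->; rewrite mul0r.
pose B := \prod_k (D k).2.2 q.
have B0 : B != 0 by apply/prodf_neq0 => k _; case: (hq k).
exists (coords (g q) i / B); first by rewrite mulf_neq0 // invr_eq0.
move=> j; have [bj ej] := hq j.
have -> : coords (g q) j = coords (g q) i * ((D j).2.1 q / (D j).2.2 q).
  by rewrite -ej /coord_ratio mulrC divfK.
have pj : \prod_(k | k != j) (D k).2.2 q != 0.
  by apply/prodf_neq0 => k _; case: (hq k).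
rewrite -mulrA; congr (_ * _); rewrite /B (bigD1 j) //=.
by field; rewrite pj.
Qed.

(** A rational map from V x T to a family of projective varieties over T is
    defined at the generic point of the divisor V x t0: write its homogeneous
    coordinates as sums of products phi_k(v) Psi_jk(t) with linearly
    independent phi_k and divide them all by a Psi_jk of least order at t0. *)
Lemma extend_over_fibre (g : VT -> Y) : rational_over g ->
  exists (g' : VT -> Y) (W : set VT),
    [/\ rat_eq g' g, morphism_on W g', exists v, W (v, t0) &
        forall p, W p -> pi (g' p) = p.2].
Proof.
move=> [[W0 [p W0p] mg] /rat_eqP over].
have [] := @tensor_coords g p; first by exists W0.
move=> U [O [a [[oU Up] [oO Op] ta /generically_near hc]]].
have [m [phi [Psi [rphi rPsi ea li]]]] := tensor_family gT ta.
have gU : @generically K VT (fun q => U q.1 /\ O q.2).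
  apply: (generically_near (X := VT) (x := p)).
  exact: (near_open (X := VT) (prod_openX gV gT oU oO)).
have coords_neq0 (y : Y) : exists j, coords y j != 0 by exact: hcoord_neq0.
(* Not all Psi_jk vanish, since the coordinates of g do not all vanish. *)
have [k1 [j1 jk1]] : exists (k : 'I_m) (j : 'I_M.+1), ~ rat_eq (Psi j k) (fun=> 0).
  apply: contrapT => H.
  have h0 : @generically K VT (fun q => forall j k, Psi j k q.2 = 0).
    apply: (generically_ord gVT irrVT) => j; apply: (generically_ord gVT irrVT) => k.
    apply: (generically_snd (P := fun t => Psi j k t = 0) gV gT).
      by exists p.1.
    by apply/rat_eqP; apply: contrapT => n; apply: H; exists k, j.
  have [q [[Uq _] [[c c0 hq] q0]]] := generically_ex (genericallyI gVT irrVT gU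
    (genericallyI gVT irrVT hc h0)).
  have [j /eqP] := coords_neq0 (g q); apply; rewrite hq ea // big1 ?mulr0 //.
  by move=> k _; rewrite q0 mulr0.
have rPsi' (jk : 'I_M.+1 * 'I_m) : local_ring setT (Psi jk.1 jk.2).
  by exists p.2 => //; exact: rPsi.
(* Psi_(j2,k2) has least order at t0. *)
have [[j2 k2] /= hdiv] := divides_all irrT smooth (j1, k1) rPsi'.
have /boolp.choice [theta0 hth0] : forall jk : 'I_M.+1 * 'I_m, exists theta,
    regular_at t0 theta /\ generically (fun t => Psi jk.1 jk.2 t = Psi j2 k2 t * theta t).
  by move=> jk; have [th r e] := hdiv jk; exists th.
pose theta j k := theta0 (j, k).
have rth j k : regular_at t0 (theta j k) by case: (hth0 (j, k)).
have eth j k : generically (fun t => Psi j k t = Psi j2 k2 t * theta j k t).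
  by case: (hth0 (j, k)).
have nz2 : ~ rat_eq (Psi j2 k2) (fun=> 0).
  move=> /rat_eqP e; apply: jk1; apply/rat_eqP.
  by apply: genericallyW (genericallyI gT irrT e (eth j1 k1)) => t [e1 ->]; rewrite e1 mul0r.
have gnz2 := generically_neq0 gT (rPsi' (j2, k2)) nz2.
have th2 : theta j2 k2 t0 = 1.
  apply: (near_self (X := T) (P := fun t => theta j2 k2 t = 1)).
  apply: (near_eq_generic gT irrT) => //; first exact: reg_cst.
  apply/rat_eqP; apply: genericallyW (genericallyI gT irrT gnz2 (eth j2 k2)).
  by move=> t [/= n e]; apply: (mulfI n); rewrite mulr1.
have [O' [oO' O't0 hO']] : near_point t0 (fun t => forall j k, regular_at t (theta j k)).
  by apply: (near_ord gT) => j; apply: (near_ord gT) => k; exact: (reg_near gT).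
pose a' j (q : VT) := \sum_k phi k q.1 * theta j k q.2.
have ra' j (q : VT) : U q.1 /\ O' q.2 -> regular_at q (a' j).
  move=> [Uq Oq]; apply: (reg_sum gVT) => k _; apply: (reg_mul gVT).
    have [_ _ r] := morphism_fst gV gT.
    exact: (r q (phi k) I (rphi _ _ Uq)).
  have [_ _ r] := morphism_snd gV gT.
  exact: (r q (theta j k) I (hO' _ Oq j k)).
(* The new coordinate a'_j2 does not vanish identically on the fibre over t0:
   its coefficient on phi_k2 there is 1. *)
have [v0 [Uv0 av0]] : exists v0, U v0 /\ a' j2 (v0, t0) != 0.
  apply: contrapT => H.
  have /(_ k2) : forall k, theta j2 k t0 = 0.
    apply: li => v Uv; apply/eqP/negPn/negP => n; apply: H; exists v; split=> //.
    by rewrite /a' /=; under eq_bigr do rewrite mulrC.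
  by rewrite th2 => /eqP; rewrite oner_eq0.
pose W := [set q : VT | (U q.1 /\ O' q.2) /\ a' j2 q != 0].
have oW : is_open VT W.
  apply: (@open_neq0 _ VT gVT [set q | U q.1 /\ O' q.2] (a' j2)); last exact: ra'.
  exact (prod_openX gV gT oU oO').
have W0' : W (v0, t0) by [].
pose beta (q : VT) : proj_space K M := proj_pt (\val (g q)).1 (fun j => a' j q).
have mbeta : @morphism_on K VT (proj_space K M) W beta.
  apply: (morphism_proj (A := a')) => //; first by move=> q j [/ra'].
  by move=> q [_ n]; apply: proj_ptE; exists j2.
have mgam : @morphism_on K VT PT W (fun q => (beta q, q.2)).
  apply: morphism_pair => //.
  by apply: (morphism_sub gVT oW _ (morphism_snd gV gT)).
have egam : @generically K VT (fun q => (beta q, q.2) = \val (g q)).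
  have h1 : generically (fun t : T => Psi j2 k2 t != 0 /\
      forall j k, Psi j k t = Psi j2 k2 t * theta j k t).
    apply: (genericallyI gT irrT) => //; apply: (generically_ord gT irrT) => j.
    exact: (generically_ord gT irrT).
  have nV : exists v : V, True by exists v0.
  have := genericallyI gVT irrVT gU (genericallyI gVT irrVT hc
    (genericallyI gVT irrVT over (generically_snd gV gT nV h1))).
  apply: genericallyW => q [[Uq _] [[c c0 hq] [piq [n hPsi]]]].
  have haa' j : a j q = Psi j2 k2 q.2 * a' j q.
    rewrite ea // mulr_sumr; apply: eq_bigr => k _.
    by rewrite hPsi mulrCA.
  rewrite [RHS]surjective_pairing -piq; congr (_, _).
  have [|e e0 he] := @proj_ptE K M (\val (g q)).1 (fun j => a' j q).
    have [j] := coords_neq0 (g q); rewrite hq haa' => h; exists j.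
    by apply: contraNneq h => ->; rewrite !mulr0.
  apply: (@proj_ext _ _ _ _ (e / (c * Psi j2 k2 q.2))) => j.
  rewrite he; have := hq j; rewrite /coords => ->; rewrite haa'.
  by field; rewrite n c0.
have clY : is_closed (variety_over_set Y : set PT) := @variety_over_closed K T Y.
have inY q : W q -> variety_over_set Y (beta q, q.2).
  apply: (morphism_closed gVT irrVT clY mgam).
  by apply: genericallyW egam => q' ->; exact: set_mem (valP (g q')).
pose g' (q : VT) : Y := insubd (g q) ((beta q, q.2) : PT).
have g'W q : W q -> \val (g' q) = (beta q, q.2).
  by move=> Wq; rewrite /g' insubdK //; apply: mem_set; exact: inY.
exists g', W; split.
- apply/rat_eqP; apply: genericallyW egam => q e.
  by apply: val_inj; rewrite /g' e insubdK // (valP (g q)).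
- apply: morphism_into_sub => //.
  by apply: (morphism_eq gVT _ mgam) => q Wq /=; rewrite g'W.
- by exists v0.
- by move=> q Wq; rewrite /structure_map g'W.
Qed.

(** In particular g has a limit at t0, to be compared with the limit of f. *)
Lemma restriction_exists (g : VT -> Y) : rational_over g ->
  exists gt : V -> fibre pi t0, restricts_to g gt.
Proof.
move=> /extend_over_fibre [g' [W [e mg [v0 W0] hpi]]].
have inF v : W (v, t0) -> fibre_set pi t0 (g' (v, t0)) by move=> /hpi.
pose z0 : fibre pi t0 := exist _ (g' (v0, t0)) (mem_set (inF _ W0)).
exists (fun v => insubd z0 (g' (v, t0))), g', W; split=> //; first by exists v0.
have [oW _ _] := mg; have oW' : near_point ((v0, t0) : VT) W by exact: near_open.
apply/rat_eqP; apply: genericallyW (generically_slice gV gT oW') => v Wv.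
by rewrite insubdK //; exact (mem_set (inF _ Wv)).
Qed.

End Extension.

(** * Restricting rational maps to the fibres of a family *)

Section Restriction.
Context (K : closedFieldType) (T : space K) (gT : geometric T) (sT : separated T).
Context (Y : variety_over T) (X : space K) (gX : geometric X) (irrX : irreducible X).
Local Notation pi := (@structure_map K T Y).
Local Notation PT := (prod_space (proj_space K (variety_over_dim Y)) T).

Lemma family_geometric : geometric Y.
Proof. exact: sub_geometric (prod_geometric (proj_geometric _ _) gT). Qed.

Lemma family_separated : separated Y.
Proof.
apply: sub_separated; first exact: prod_geometric (proj_geometric _ _) gT.
exact: prod_separated (proj_geometric _ _) gT (@proj_separated _ _) sT.
Qed.

Lemma restriction_rational t (g : prod_space X T -> Y) (gt : X -> fibre pi t) :
  restricts_to g gt -> rational gt.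
Proof.
move=> [g' [W [_ mg [x0 Wx0] /rat_eqP e]]].
have gY := family_geometric.
have [oW _ _] := mg.
have gs := generically_slice gX gT (near_open (X := prod_space X T) oW Wx0).
have [O [oO nO hO]] := genericallyI gX irrX gs e.
exists O => //; apply: morphism_into_sub => //.
apply: (morphism_eq gX (f := fun x => g' (x, t))); first by move=> x /hO [].
have := morphism_comp gX (prod_slice t gX gT) mg.
by apply: morphism_sub => // x /hO [].
Qed.

(** Restriction to a fibre commutes with composition: both sides of
    f = g o (h x 1) are morphisms on an open set meeting X x t, and a generic
    equality between them propagates to X x t. *)
Lemma restriction_comp (irrT : irreducible T) (V : space K) (gV : geometric V)
    (irrV : irreducible V) t
    (f : prod_space X T -> Y) (ft : X -> fibre pi t)
    (g : prod_space V T -> Y) (gt : V -> fibre pi t) (h : X -> V) :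
  dominant_rational h -> restricts_to f ft -> restricts_to g gt ->
  rat_eq f (fun p => g (h p.1, p.2)) -> rat_eq ft (gt \o h).
Proof.
move=> dh [f' [Wf [/rat_eqP ef mf [x0 Wfx0] /rat_eqP eft]]].
move=> [g' [Wg [/rat_eqP eg mg [v0 Wgv0] /rat_eqP egt]]] /rat_eqP efg.
have gXT := prod_geometric gX gT; have irrXT := prod_irreducible gX gT irrX irrT.
have [[Wh nWh mh] _] := dh; have [oWh _ _] := mh.
have gWh : generically Wh by exists Wh.
have mh1 : @morphism_on K (prod_space X T) (prod_space V T)
    (setT `&` fst @^-1` Wh) (fun p => (h p.1, p.2)).
  have m1 := morphism_comp gXT (morphism_fst gX gT) mh.
  apply: (morphism_pair gXT m1).
  by apply: (morphism_sub gXT _ _ (morphism_snd gX gT)) => //; case: m1.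
have pull (P : V * T -> Prop) : @generically K (prod_space V T) P ->
    @generically K (prod_space X T) (fun p => P (h p.1, p.2)).
  move=> [O [oO [[v s] Ovs] hO]].
  have := generically_slice gV gT (near_open (X := prod_space V T) oO Ovs).
  move=> /(generically_pullback dh) /(genericallyI gX irrX gWh).
  move=> /generically_ex [x [Wx Ox]].
  have W1 : (setT `&` fst @^-1` Wh) (x, s) by [].
  have := morphism_near mh1 W1 (near_open (X := prod_space V T) oO Ox).
  by move=> /generically_near; apply: genericallyW => p /hO.
pose F := g' \o (fun p : X * T => (h p.1, p.2)).
have mF : @morphism_on K (prod_space X T) Y
    ((setT `&` fst @^-1` Wh) `&` (fun p => (h p.1, p.2)) @^-1` Wg) F.
  exact: morphism_comp mh1 mg.
have eF : @generically K (prod_space X T) (fun p => f' p = F p).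
  apply: genericallyW (genericallyI gXT irrXT ef (genericallyI gXT irrXT efg (pull _ eg))).
  by move=> p [-> [-> e]]; rewrite /F /= e.
set WF := _ `&` _ in mF.
have oWW : is_open (prod_space X T) (Wf `&` WF).
  by apply: (openI gXT); [case: mf|case: mF].
have eqF p : (Wf `&` WF) p -> f' p = F p.
  apply: (morphism_ext gXT irrXT family_separated (W := Wf `&` WF)).
  - by apply: morphism_sub mf => // q [].
  - by apply: morphism_sub mF => // q [].
  - exact/rat_eqP.
have [oWf _ _] := mf; have [oWg _ _] := mg.
have s1 := generically_slice gX gT (near_open (X := prod_space X T) oWf Wfx0).
have s2 := generically_slice gV gT (near_open (X := prod_space V T) oWg Wgv0).
have := genericallyI gX irrX s1 (genericallyI gX irrX eft (genericallyI gX irrX gWh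
  (generically_pullback dh (genericallyI gV irrV s2 egt)))).
move=> H; apply/rat_eqP; apply: genericallyW H => x [Wfx [e1 [Whx [Wgx e2]]]].
apply: val_inj; rewrite -e1 eqF; last by split.
by rewrite /F /= e2.
Qed.

End Restriction.

Lemma dominant_of_comp (K : closedFieldType) (X V Z : space K)
    (h : X -> V) (c : V -> Z) (u : X -> Z) :
  geometric X -> irreducible X -> geometric V -> irreducible V ->
  dominant_rational h -> dominant_rational u -> rat_eq u (c \o h) -> rational c ->
  dominant_rational c.
Proof.
move=> gX iX gV iV dh du /rat_eqP e [W nW mc]; split; first by exists W.
apply: (dominantP gV iV) => P [O [oO nO hO]].
have gW : generically W by exists W; split=> //; case: mc.
have gO : generically O by exists O.
have [x [ex [Wx Ox]]] := generically_ex (genericallyI gX iX e (genericallyI gX iX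
  (generically_pullback dh gW) (generically_pullback du gO))).
have Oc : O (c (h x)) by rewrite /= in ex Ox; rewrite -ex.
have := morphism_near mc Wx (near_open oO Oc).
by move=> /generically_near; apply: genericallyW => v /hO.
Qed.

(** * The limit of a generically trivial family *)

(** With c the limit of g, f_t0 = c o h; comparing the degrees of f_t0 and f_t
    shows that c is birational, and g_t o c^-1 is the required map. *)
Theorem limit_birationally_equivalent (K : closedFieldType) (n d d0 : nat)
  (X : proj_variety K) (T : quasiproj_variety K) (t0 : T)
  (Y : variety_over T) (f : prod_space X T -> Y)
  (ft : forall t : T, X -> fibre (@structure_map _ _ Y) t) :
  cotangent_dim t0 1 ->
  family_of_varieties t0 Y n d0 ->
  family_of_dominant_maps f ft ->
  generically_trivial t0 f ->
  (forall t : T, degree (ft t) d) ->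
  forall t : T, t <> t0 -> birationally_equivalent (ft t0) (ft t).
Proof.
move=> smooth [famY [_ [irr0 _] _]] [_ famf] [V [h [g [dh [_ rg] gtriv efg]]]] deg t tt0.
have gX : geometric X := sub_geometric _ (proj_geometric K _).
have gV : geometric V := sub_geometric _ (proj_geometric K _).
have gT : geometric T := sub_geometric _ (proj_geometric K _).
have sT : separated T := sub_separated (proj_geometric K _) (@proj_separated K _).
have irrX : irreducible X := @proj_variety_irreducible K X.
have irrV : irreducible V := @proj_variety_irreducible K V.
have irrT : irreducible T := @quasiproj_variety_irreducible K T.
have gY := @family_geometric K T gT Y.
have sY := @family_separated K T gT sT Y.
pose pi := @structure_map K T Y.
have gF s : geometric (fibre pi s) := sub_geometric (fibre_set pi s) gY.
have sF s : separated (fibre pi s) by exact: sub_separated.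
have irr0' : irreducible (fibre pi t0) by [].
have [_ irrt _] := famY t tt0.
have [gt rgt bgt] := gtriv t tt0.
have [c rc] := restriction_exists irrT smooth gV irrV rg.
have [rf0 df0 _] := famf t0; have [rft dft _] := famf t.
have e0 := restriction_comp gT sT gX irrX irrT gV irrV dh rf0 rc efg.
have et := restriction_comp gT sT gX irrX irrT gV irrV dh rft rgt efg.
have dc : dominant_rational c.
  exact: dominant_of_comp gX irrX gV irrV dh df0 e0 (restriction_rational gT gV irrV rc).
have degh := degree_birational gX irrX gV irrV (gF t) irrt dh bgt et (deg t).
have [_ [c' [dc' cc' c'c]]] : birational c.
  apply: birational_of_surjective => //.
  exact: pullback_surjective gX irrX gV irrV (gF t0) irr0' dh dc e0 degh (deg t0).
exists (gt \o c'); split.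
  apply: (birational_comp (Y := V)) => //.
  by split=> //; exists c; split.
move/rat_eqP: e0 => e0; move/rat_eqP: et => et.
move/rat_eqP: (pullback_rat_eq dh cc') => e.
apply/rat_eqP; apply: genericallyW (genericallyI gX irrX e0 (genericallyI gX irrX et e)).
by move=> x [/= -> [-> ->]].
Qed.

Theorem proposition2p4 (R : realType) (n d d0 : nat)
  (X : proj_variety R[i]) (T : quasiproj_variety R[i]) (t0 : T)
  (Y : variety_over T) (f : prod_space X T -> Y)
  (ft : forall t : T, X -> fibre (@structure_map _ _ Y) t) :
  has_dim X n ->
  smooth_curve T ->
  family_of_varieties t0 Y n d0 ->
  family_of_dominant_maps f ft ->
  generically_trivial t0 f ->
  (forall t : T, degree (ft t) d) ->
  forall t : T, t <> t0 -> birationally_equivalent (ft t0) (ft t).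
Proof. by move=> _ [_ smooth]; exact: limit_birationally_equivalent. Qed.
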